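(* For every positive integer $n$, in the ring $\mathbb{Z}[u,v][x_1,\ldots,x_n]$, \[ \mathcal{A}_n(u,v;x_1,\ldots,x_n)=\sum_{T\in \mathrm{TSPP}_{n-1}} \omega_{\pi(T)}(u,v)\, s_{\pi(T)}(x_1,\ldots,x_n), \] where, writing $\pi(T)=(a_1,\ldots,a_l\mid c_1,\ldots,c_l)$ in Frobenius notation, \[ \omega_{\pi(T)}(u,v)=u^{\sum_{i=1}^l (a_i+1)}\,(1-u-v)^{\sum_{i=1}^l (c_i-1-a_i)}\,v^{\binom{n}{2}-\sum_{i=1}^l c_i} \] (for $\pi(T)$ the empty partition, $l=0$ and $\omega=v^{\binom n2}$). Equivalently, if $\mathrm{diag}(T)=(a_1,\ldots,a_l\mid b_1,\ldots,b_l)$ then $c_i=b_i+1$ and $\omega_{\pi(T)}=u^{\sum(a_i+1)}(1-u-v)^{\sum(b_i-a_i)}v^{\binom n2-\sum (b_i+1)}$. For instance $\mathcal A_2=v+u\,s_{(1,1)}$ and $\mathcal A_3=v^3+uv^2s_{(1,1)}+u(1-u-v)v\,s_{(1,1,1)}+u^2v\,s_{(2,1,1)}+u^3s_{(2,2,2)}$.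
   Context: For variables $x_1,\ldots,x_n$, the antisymmetrizer is $\mathrm{ASym}_{x_1,\ldots,x_n} f(x_1,\ldots,x_n)=\sum_{\sigma\in S_n}\mathrm{sgn}(\sigma) f(x_{\sigma(1)},\ldots,x_{\sigma(n)})$. Define \[ \mathcal{A}_n(u,v;x_1,\ldots,x_n)=\frac{\mathrm{ASym}_{x_1,\ldots,x_n}\Big[\prod_{i=1}^n x_i^{i-1}\prod_{1\le i<j\le n}\big(v+(1-u-v)x_i+u x_i x_j\big)\Big]}{\prod_{1\le i<j\le n}(x_j-x_i)}. \] $s_\lambda(x_1,\ldots,x_n)$ is the Schur polynomial. For a partition $\lambda$ with conjugate $\lambda'$ and Durfee square side $l=\max\{i:\lambda_i\ge i\}$, its Frobenius notation is $(\lambda_1-1,\ldots,\lambda_l-l\mid \lambda'_1-1,\ldots,\lambda'_l-l)$ (the empty partition is $(\,\mid\,)$). A plane partition inside an $(m,m,m)$-box is an array $(T_{i,j})_{1\le i,j\le m}$ of integers in $\{0,\ldots,m\}$ weakly decreasing along rows and columns; equivalently the set $\{(i,j,k): k\le T_{i,j}\}\subseteq\{1,\ldots,m\}^3$. It is totally symmetric if this set is invariant under all permutations of coordinates. $\mathrm{TSPP}_m$ is the set of totally symmetric plane partitions inside an $(m,m,m)$-box ($\mathrm{TSPP}_0$ consists of the empty one). For $T\in\mathrm{TSPP}_{n-1}$, $\mathrm{diag}(T)$ is the conjugate of the partition $(T_{1,1},T_{2,2},\ldots,T_{n-1,n-1})$; if $\mathrm{diag}(T)=(a_1,\ldots,a_l\mid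 b_1,\ldots,b_l)$ in Frobenius notation then $\pi(T)$ is the partition with Frobenius notation $(a_1,\ldots,a_l\mid b_1+1,\ldots,b_l+1)$. *)

(* Defs.v *)
From HB Require Import structures.
From mathcomp Require Import all_boot all_order all_algebra all_fingroup.
From mathcomp Require Import mpoly.

Set Implicit Arguments.
Unset Strict Implicit.
Unset Printing Implicit Defensive.

Import Order.TTheory GRing.Theory.
Local Open Scope ring_scope.

Definition Zuv := {mpoly int[2]}.
Definition uu : Zuv := 'X_(0 : 'I_2).
Definition vv : Zuv := 'X_(1 : 'I_2).

Definition asym (R : comRingType) (n : nat)
    (F : ('I_n -> {mpoly R[n]}) -> {mpoly R[n]}) : {mpoly R[n]} :=
  \sum_(s : 'S_n) (-1) ^+ (odd_perm s) * F (fun i => 'X_(s i)).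

Definition An_summand (R : comRingType) (u v : R) (n : nat)
    (x : 'I_n -> {mpoly R[n]}) : {mpoly R[n]} :=
  (\prod_(i < n) x i ^+ i) *
  \prod_(i < n) \prod_(j < n | (i < j)%N)
     (v%:MP + (1 - u - v)%:MP * x i + u%:MP * x i * x j).

Definition vdm (R : comRingType) (n : nat) : {mpoly R[n]} :=
  \prod_(i < n) \prod_(j < n | (i < j)%N) ('X_j - 'X_i).

(* ---------- partitions (as weakly decreasing seq nat, 0-indexed) ---------- *)

Definition maxpart (la : seq nat) : nat := \max_(x <- la) x.

Definition conj_part (la : seq nat) : seq nat :=
  mkseq (fun j => count (fun x => (j < x)%N) la) (maxpart la).

Definition durfee (la : seq nat) : nat :=
  \max_(i < size la | (i < nth 0%N la i)%N) i.+1.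

Definition frob_arms (la : seq nat) : seq nat :=
  mkseq (fun i => nth 0%N la i - i.+1)%N (durfee la).
Definition frob_legs (la : seq nat) : seq nat :=
  mkseq (fun i => nth 0%N (conj_part la) i - i.+1)%N (durfee la).

(* The partition with Frobenius notation (a_1..a_l | c_1..c_l):
   the cell (i,j) (0-indexed row i, column j) belongs to it iff either
   i <= j, i < l and j <= i + a_i (arm of the i-th diagonal cell), or
   j < i, j < l and i <= j + c_j (leg of the j-th diagonal cell). *)
Definition frob_cell (a c : seq nat) (i j : nat) : bool :=
  let l := size a in
  if (i <= j)%N then (i < l)%N && (j <= i + nth 0%N a i)%N
  else (j < l)%N && (i <= j + nth 0%N c j)%N.

Definition part_of_frob (a c : seq nat) : seq nat :=
  let N := (size a + sumn a + sumn c).+1 in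
  [seq x <- [seq count (frob_cell a c i) (iota 0 N) | i <- iota 0 N] | (0 < x)%N].

Definition in_shape (la : seq nat) (r s : nat) (c : 'I_r * 'I_s) : bool :=
  (c.2 < nth 0%N la c.1)%N.

(* A filling of the cells of la with entries in {1..n} (here 'I_n), cells
   outside la being set to 0 (normalisation), rows weakly increasing and
   columns strictly increasing. *)
Definition ssyt (n : nat) (la : seq nat)
    (t : {ffun 'I_(size la) * 'I_(maxpart la) -> 'I_n}) : bool :=
  [forall c, ~~ in_shape la c ==> (val (t c) == 0%N)] &&
  [forall c1, forall c2,
     (in_shape la c1 && in_shape la c2) ==>
     ((((c1.1 == c2.1) && (c1.2 < c2.2)%N) ==> (t c1 <= t c2)%N) &&
      (((c1.2 == c2.2) && (c1.1 < c2.1)%N) ==> (t c1 < t c2)%N))].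

Definition schur (R : comRingType) (n : nat) (la : seq nat) : {mpoly R[n]} :=
  \sum_(t : {ffun 'I_(size la) * 'I_(maxpart la) -> 'I_n} | ssyt t)
     \prod_(c | in_shape la c) 'X_(t c).

(* T : {ffun 'I_m * 'I_m -> 'I_m.+1}, T (i,j) = T_{i+1,j+1} in {0..m}. *)
Definition pp_box (m : nat) (T : {ffun 'I_m * 'I_m -> 'I_m.+1}) : bool :=
  [forall i : 'I_m, forall j : 'I_m, forall j' : 'I_m,
     ((j <= j')%N ==> (T (i, j') <= T (i, j))%N) &&
     ((j <= j')%N ==> (T (j', i) <= T (j, i))%N)].

(* membership of the (0-indexed) cube (i,j,k) in {(i,j,k) : k <= T_{i,j}} *)
Definition pp_mem (m : nat) (T : {ffun 'I_m * 'I_m -> 'I_m.+1})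
    (i j k : 'I_m) : bool := (k < T (i, j))%N.

Definition totally_symmetric (m : nat) (T : {ffun 'I_m * 'I_m -> 'I_m.+1}) : bool :=
  [forall x : 'I_m, forall y : 'I_m, forall z : 'I_m,
     [&& pp_mem T x y z == pp_mem T y x z,
         pp_mem T x y z == pp_mem T x z y,
         pp_mem T x y z == pp_mem T z y x,
         pp_mem T x y z == pp_mem T y z x &
         pp_mem T x y z == pp_mem T z x y]].

Definition is_tspp (m : nat) (T : {ffun 'I_m * 'I_m -> 'I_m.+1}) : bool :=
  pp_box T && totally_symmetric T.

Definition tspp_diag (m : nat) (T : {ffun 'I_m * 'I_m -> 'I_m.+1}) : seq nat :=
  conj_part [seq (T (i, i) : nat) | i : 'I_m].

Definition pi_arms (m : nat) (T : {ffun 'I_m * 'I_m -> 'I_m.+1}) : seq nat :=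
  frob_arms (tspp_diag T).
Definition pi_legs (m : nat) (T : {ffun 'I_m * 'I_m -> 'I_m.+1}) : seq nat :=
  [seq b.+1 | b <- frob_legs (tspp_diag T)].

Definition pi_part (m : nat) (T : {ffun 'I_m * 'I_m -> 'I_m.+1}) : seq nat :=
  part_of_frob (pi_arms T) (pi_legs T).

Definition omega (R : comRingType) (u v : R) (n : nat) (a c : seq nat) : R :=
  u ^+ (\sum_(i < size a) (nth 0%N a i).+1)%N *
  (1 - u - v) ^+ (\sum_(i < size a) (nth 0%N c i - 1 - nth 0%N a i))%N *
  v ^+ ('C(n, 2) - \sum_(i < size a) nth 0%N c i)%N.

(* Main.v *)
Require Import Defs.
From HB Require Import structures.
From mathcomp Require Import all_boot all_order all_algebra all_fingroup.
From mathcomp Require Import mpoly.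
From mathcomp Require Import zify ring.
Import GRing.Theory.
Local Open Scope ring_scope.
Set Implicit Arguments.
Unset Strict Implicit.
Unset Printing Implicit Defensive.

(** With w = 1 - u - v one has v + w x_i + u x_i x_j = x_i (alpha_i - beta_j)
    for alpha_i = v / x_i and beta_j = - (w + u x_j).  For arbitrary alpha and
    beta the antisymmetrizer of prod_{i<j} (alpha_i - beta_j) is the determinant
    of the complete homogeneous polynomials h_c(alpha_j, beta_j): peel off the
    image m of the first index; since E(t) = prod_j (t - beta_j) vanishes at
    beta_m, the factor prod_{j != m} (alpha_m - beta_j) is the divided
    difference of E at alpha_m and beta_m, hence a combination of the
    h_c(alpha_m, beta_m) with coefficients independent of m.
    The relation alpha beta = - w alpha - u v then turns this determinant into
    the one with rows
      v^c x^(n-1-c) + (-1)^c u x^n (w + u x)^(c-1)     (0 <= c < n).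
    Expanding over the set S of the rows c whose second summand is taken, and
    subtracting from each chosen row a multiple of the next one, replaces the
    strict partition S by a sum over the strict partitions interlacing with it.
    Iterating yields alternants indexed by chains of interlacing strict
    partitions.  The numbers T_{i,i+k} - (i+k) (truncated at 0, 0-indexed) of a
    totally symmetric plane partition T form such a chain, and this is a
    bijection; the first strict partition of the chain is the leg sequence of
    pi(T), and the number of further steps during which its i-th part survives
    is the i-th arm.
    The same row operation on Jacobi-Trudi determinants removes the largest
    letter from semistandard tableaux, which identifies the alternants with
    the Vandermonde product times Schur polynomials. *)

(** * Antisymmetrizers as determinants *)

(** The complete homogeneous polynomial of degree k - 1 in a and b, that is (a^k - b^k) / (a - b),
    with value 0 at k = 0. *)
Definition hom2 (R : nzRingType) (k : nat) (a b : R) : R :=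
  \sum_(i < k) a ^+ (k.-1 - i) * b ^+ i.

Lemma hom2_0 (R : nzRingType) (a b : R) : hom2 0 a b = 0.
Proof. by rewrite /hom2 big_ord0. Qed.

Lemma hom2_1 (R : nzRingType) (a b : R) : hom2 1 a b = 1.
Proof. by rewrite /hom2 big_ord1 /= mul1r. Qed.

Lemma hom2Sl (R : comNzRingType) k (a b : R) :
  hom2 k.+1 a b = a ^+ k + b * hom2 k a b.
Proof.
rewrite /hom2 big_ord_recl subn0 mulr1 mulr_sumr; congr (_ + _).
apply: eq_bigr => i _; rewrite /bump /= exprS mulrCA; congr (_ * (_ ^+ _ * _)).
by case: k i => [[]|k i] //=; rewrite add1n subSS.
Qed.

Lemma hom2Sr (R : comNzRingType) k (a b : R) :
  hom2 k.+1 a b = a * hom2 k a b + b ^+ k.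
Proof.
rewrite /hom2 big_ord_recr /= subnn mul1r mulr_sumr; congr (_ + _).
apply: eq_bigr => i _; rewrite mulrA -exprS; congr (_ ^+ _ * _).
by case: k i => [[]|k i] //=; rewrite subSn // -ltnS.
Qed.

Lemma det_unitrig (R : comNzRingType) n (U : 'M[R]_n) :
  (forall i, U i i = 1) -> (forall i j : 'I_n, (j < i)%N -> U i j = 0) ->
  \det U = 1.
Proof.
move=> U1 U0; rewrite -det_tr det_trig; first by apply: big1 => i _; rewrite mxE.
by apply/is_trig_mxP => i j ij; rewrite mxE U0.
Qed.

(** Homogenized expansion of the polynomial with roots [b j]. One family [e] serves all [a] and [x],
    so [asym_det] can use it at two points and in every column. *)
Lemma homog_prod (R : comNzRingType) n (b : 'I_n -> R) :
  exists e : nat -> R, e n = 1 /\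
  forall a x, \prod_(j < n) (a - x * b j) =
              \sum_(d < n.+1) e d * x ^+ (n - d) * a ^+ d.
Proof.
elim: n b => [|n IHn] b.
  exists (fun=> 1); split=> // a x.
  by rewrite big_ord0 big_ord1 !mulr1.
have [e [en1 eP]] := IHn (fun j => b (widen_ord (leqnSn n) j)).
pose c := b ord_max.
exists (fun d => (if d == 0%N then 0 else e d.-1) - (if (d <= n)%N then c * e d else 0)).
split=> [|a x]; first by rewrite ltnn subr0.
rewrite big_ord_recr /= eP mulrBr.
under [RHS]eq_bigr => d _ do rewrite !mulrBl.
rewrite sumrB; congr (_ - _).
  rewrite [RHS]big_ord_recl /= !mul0r add0r mulr_suml; apply: eq_bigr => d _.
  by rewrite /bump /= add1n /= subSS exprS; ring.
rewrite [RHS]big_ord_recr /= ltnn !mul0r addr0 mulr_suml; apply: eq_bigr => d _.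
rewrite -ltnS ltn_ord subSn ?exprS; last by rewrite -ltnS.
by rewrite /c; ring.
Qed.

Lemma prod_ord_gt0 (R : comNzRingType) n (F : 'I_n.+1 -> R) :
  \prod_(j < n.+1 | (0 < j)%N) F j = \prod_(j < n) F (lift ord0 j).
Proof. by rewrite big_mkcond big_ord_recl /= mul1r. Qed.

Lemma prod_ord_gtS (R : comNzRingType) n (i : 'I_n) (F : 'I_n.+1 -> R) :
  \prod_(j < n.+1 | (lift ord0 i < j)%N) F j =
  \prod_(j < n | (i < j)%N) F (lift ord0 j).
Proof. by rewrite big_mkcond big_ord_recl /= mul1r [RHS]big_mkcond. Qed.

Lemma big_Sn (R : nmodType) n (F : 'S_n.+1 -> R) :
  \sum_s F s = \sum_(m < n.+1) \sum_(t : 'S_n) F (lift_perm ord0 m t).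
Proof.
have inj : injective (fun p : 'I_n.+1 * 'S_n => lift_perm ord0 p.1 p.2).
  move=> [m t] [m' t'] /= E.
  have Em : m = m' by rewrite -(lift_perm_id ord0 m t) E lift_perm_id.
  subst m'; congr pair; apply/permP => k; apply: (@lift_inj _ m).
  by rewrite -!(lift_perm_lift ord0) E.
have bij := inj_card_bij inj _.
rewrite pair_bigA (reindex _ (onW_bij _ (bij _))) //.
by rewrite card_prod card_ord !card_Sn factS.
Qed.

Section AsymDet.
Variable R : idomainType.

(** Division-free form of the product in alpha and beta: [A / X] is alpha, [b] is beta, and each
    factor is multiplied by its [X]. *)
Definition asym_term n (A X b : 'I_n -> R) (s : 'S_n) : R :=
  (\prod_(i < n) X (s i) ^+ i) *
  \prod_(i < n) \prod_(j < n | (i < j)%N) (A (s i) - X (s i) * b (s j)).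

Definition homM n (A X b : 'I_n -> R) : 'M[R]_n :=
  \matrix_(r, j) (X j ^+ r * hom2 (n - r) (A j) (X j * b j)).

Lemma asym_term_lift n (A X b : 'I_n.+1 -> R) m (t : 'S_n) :
  asym_term A X b (lift_perm ord0 m t) =
  \prod_(j < n) (A m - X m * b (lift m j)) *
  ((\prod_(j < n) X (lift m j)) *
   asym_term (A \o lift m) (X \o lift m) (b \o lift m) t).
Proof.
have E G : \prod_(j < n) G (t j) = \prod_(j < n) G j :> R.
  by rewrite [RHS](reindex_inj (@perm_inj _ t)).
rewrite /asym_term !big_ord_recl lift_perm_id expr0 mul1r prod_ord_gt0.
under [X in _ * (X * _)]eq_bigr => j _ do rewrite lift_perm_lift.
rewrite (E (fun j => A m - X m * b (lift m j))).
under [X in _ * (_ * X)]eq_bigr => i _ do rewrite prod_ord_gtS lift_perm_lift.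
under [X in _ * (_ * X)]eq_bigr => i _ do
  under eq_bigr => j _ do rewrite lift_perm_lift.
under [X in X * _]eq_bigr => i _ do rewrite lift_perm_lift lift0 exprS.
rewrite big_split /= (E (fun j => X (lift m j))) /=; ring.
Qed.

(** Induction along the image m of the first index. The hypothesis allows cancelling
    [A m - X m * b m], which presents the product over the other indices as a divided difference. *)
Theorem asym_det n (A X b : 'I_n -> R) :
  (forall m, A m - X m * b m != 0) ->
  \sum_(s : 'S_n) (-1) ^+ s * asym_term A X b s = \det (homM A X b).
Proof.
elim: n A X b => [|n IHn] A X b nz.
  by apply: eq_bigr => s _; rewrite /asym_term !big_ord0 mulr1.
pose r m := \prod_(j < n) (A m - X m * b (lift m j)).
pose M' : 'M[R]_n.+1 := \matrix_(i, j) if i == ord0 then r j else homM A X b i j.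
transitivity (\det M').
  rewrite (expand_det_row _ ord0) big_Sn.
  apply: eq_bigr => m _; rewrite mxE eqxx.
  transitivity (\sum_(t : 'S_n) (r m * ((-1) ^+ m * (\prod_(j < n) X (lift m j)))) *
     ((-1) ^+ t * asym_term (A \o lift m) (X \o lift m) (b \o lift m) t)).
    apply: eq_bigr => t _; rewrite asym_term_lift odd_lift_perm /= signr_addb signr_odd -/(r m).
    by move: (r m) (\prod_j _) (asym_term _ _ _ _) ((-1) ^+ m) ((-1) ^+ t); clear => *; ring.
  rewrite -mulr_sumr IHn; last by move=> k; apply: nz.
  rewrite -!mulrA; congr (_ * _); rewrite /cofactor add0n; congr (_ * _).
  pose D := diag_mx (\row_(j < n) X (lift m j)).
  have -> : \prod_(j < n) X (lift m j) = \det D.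
    by rewrite det_diag; apply: eq_bigr => j _; rewrite mxE.
  rewrite mulrC -det_mulmx; congr (\det _); apply/matrixP => i j.
  by rewrite mul_mx_diag !mxE /= /bump /= add1n subSS exprS; ring.
have [e [en1 eP]] := homog_prod b.
(* Only the first row of [U] differs from the identity: it combines the rows of [homM] with the
   coefficients [e], and its corner entry is [e n.+1], which is 1. *)
pose U : 'M[R]_n.+1 :=
  \matrix_(i, k) if i == ord0 then e (n.+1 - k)%N else (i == k)%:R.
have detU : \det U = 1.
  apply: det_unitrig => [i|i j ij]; rewrite mxE; case: eqP => [i0|_].
  - by rewrite i0 subn0.
  - by rewrite eqxx.
  - by rewrite i0 in ij.
  - by case: eqP ij => // ->; rewrite ltnn.
rewrite -[RHS]mul1r -detU -det_mulmx; congr (\det _).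
apply/matrixP => i j; rewrite !mxE; case: ifPn => [/eqP->|i0]; last first.
  rewrite (bigD1 i) //= !mxE (negPf i0) eqxx mul1r big1 ?addr0 // => k ki.
  by rewrite !mxE (negPf i0) eq_sym (negPf ki) mul0r.
apply: (mulfI (nz j)).
have -> : (A j - X j * b j) * r j = \prod_(k < n.+1) (A j - X j * b k).
  rewrite (bigD1 j) //=; congr (_ * _); rewrite /r.
  rewrite [RHS](reindex_omap (lift j) (unlift j)) /=; last first.
    by move=> k; case: unliftP => [k' -> //|->]; rewrite eqxx.
  by apply: eq_bigl => k; rewrite liftK eqxx eq_sym neq_lift.
have root : \prod_(k < n.+1) (X j * b j - X j * b k) = 0.
  by rewrite (bigD1 j) //= subrr mul0r.
(* Subtract the vanishing product at [X j * b j]. Both products have the same coefficients, their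
   terms of degree 0 cancel, and each difference of powers is [A j - X j * b j] times a [hom2]. *)
rewrite -[LHS]subr0 -[X in _ - X = _]root !eP -sumrB mulr_sumr (reindex_inj rev_ord_inj) /=.
rewrite big_ord_recr /= subSS subnn !expr0 subrr addr0.
apply: eq_bigr => k _; rewrite !mxE eqxx subSS.
have kn := ltn_ord k; rewrite -mulrBr subrXX subKn; last lia.
by rewrite /hom2; ring.
Qed.
End AsymDet.

(** * Multilinear expansion and the passage to hook rows *)

Lemma det_rev (R : comNzRingType) n (M : 'M[R]_n) :
  \det (\matrix_(i, j) M (rev_ord i) j) = (-1) ^+ perm (@rev_ord_inj n) * \det M.
Proof.
rewrite -det_perm -det_mulmx -row_permE; congr (\det _).
by apply/matrixP => i j; rewrite !mxE permE.
Qed.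

Lemma det_expand (R : comNzRingType) n (S : finType) (C : 'I_n -> S -> R)
    (eta : 'I_n -> S -> 'I_n -> R) :
  \det (\matrix_(i, j) \sum_s C i s * eta i s j) =
  \sum_(f : {ffun 'I_n -> S}) (\prod_i C i (f i)) * \det (\matrix_(i, j) eta i (f i) j).
Proof.
rewrite /determinant; under [RHS]eq_bigr => f _ do rewrite mulr_sumr.
rewrite exchange_big /=; apply: eq_bigr => s _.
under eq_bigr => i _ do rewrite mxE.
rewrite bigA_distr_bigA mulr_sumr; apply: eq_bigr => f _.
rewrite mulrCA; congr (_ * _); rewrite -big_split /=.
by apply: eq_bigr => i _; rewrite mxE.
Qed.

Lemma sum_pick (R : nzSemiRingType) n (F : nat -> R) k :
  \sum_(i < n) (val i == k)%:R * F i = if (k < n)%N then F k else 0.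
Proof.
case: ifP => kn; last first.
  apply: big1 => i _; case: eqP => [E|_]; last by rewrite mul0r.
  by rewrite -E ltn_ord in kn.
rewrite (bigD1 (Ordinal kn)) //= eqxx mul1r big1 ?addr0 // => i /eqP ik.
by case: eqP => [E|_]; rewrite ?mul0r //; case: ik; apply: val_inj.
Qed.

Definition hookrow (R : comNzRingType) (u v w : R) (n : nat) (x : R) (c : nat) : R :=
  v ^+ c * x ^+ (n.-1 - c) +
  (if c is b.+1 then (-1) ^+ c * (u * x ^+ n) * (w + u * x) ^+ b else 0).

(** Put b = -(w + u x) and index h by degree. Peeling h_c at one end and h_(c-1) at the other
    produces x b v h_(c-2), which the multiples of rows c - 1 and c - 2 cancel. Besides v^c
    x^(n-1-c) there remains x^(n-1) b^(c-1) (b + w), and b + w = - u x. *)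
Lemma hookrowE (R : comNzRingType) (u v w : R) n (x : R) (c : nat) : (c < n)%N ->
  let G k := x ^+ (n.-1 - k) * hom2 k.+1 v (x * - (w + u * x)) in
  hookrow u v w n x c =
  G c + (if c is b.+1 then w * G b else 0) + (if c is b.+2 then u * v * G b else 0).
Proof.
move=> cn G; rewrite /hookrow; case: c cn => [|b] cn.
  by rewrite /G hom2_1; ring.
have [k nk] : exists k, n = (b.+1 + k).+1 by exists (n - b.+2)%N; lia.
have Gb1 : G b.+1 = x ^+ k * hom2 b.+2 v (x * - (w + u * x)).
  by rewrite /G nk /= addKn.
have Gb : G b = x ^+ k.+1 * hom2 b.+1 v (x * - (w + u * x)).
  by rewrite /G nk; congr (_ ^+ _ * _); lia.
(* For b = 0 the third term is absent; the value [hom2 0 = 0] lets this case share the general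
   formula. *)
have Gb' : (if b is b'.+1 then u * v * G b' else 0) =
    u * v * (x ^+ k.+2 * hom2 b v (x * - (w + u * x))).
  rewrite /G nk; case: (b) => [|b']; first by rewrite hom2_0; ring.
  by congr (_ * (_ ^+ _ * _)); lia.
rewrite Gb' Gb Gb1 hom2Sl hom2Sr nk /= addKn -addnS.
have -> : x ^+ (b.+1 + k.+1) = x ^+ b * x ^+ k.+2 by rewrite -exprD; congr (_ ^+ _); lia.
set h := hom2 _ _ _; rewrite mulrN -mulNr exprMn [(- x) ^+ b]exprNn !exprS; ring.
Qed.

(** By [hookrowE] the two systems of rows differ by a lower unitriangular matrix. *)
Lemma det_hookrow (R : comNzRingType) (u v w : R) n (x : 'I_n -> R) :
  \det (\matrix_(c < n, j < n) hookrow u v w n (x j) c) =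
  \det (\matrix_(c < n, j < n)
          (x j ^+ (n.-1 - c) * hom2 c.+1 v (x j * - (w + u * x j)))).
Proof.
pose U : 'M[R]_n := \matrix_(c, k)
  ((val k == val c)%:R + (if val c is b.+1 then w * (val k == b)%:R else 0)
   + (if val c is b.+2 then u * v * (val k == b)%:R else 0)).
have detU : \det U = 1.
  rewrite det_trig; last first.
    apply/is_trig_mxP => -[i li] [j lj] /= ij; rewrite mxE /=.
    case: eqP => [E|_]; first by rewrite E ltnn in ij.
    case: i li ij => [|[|b]] li ij; rewrite ?add0r ?addr0 //=.
      by case: eqP => [E'|_]; [lia | rewrite mulr0].
    case: eqP => [E'|_]; [lia | rewrite mulr0 add0r].
    by case: eqP => [E'|_]; [lia | rewrite mulr0].
  apply: big1 => -[i li] _; rewrite mxE eqxx /=.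
  case: i li => [|[|b]] li; rewrite ?addr0 //=.
    by rewrite mulr0 addr0.
  case: eqP => [E'|_]; [lia | rewrite mulr0 addr0].
  by case: eqP => [E'|_]; [lia | rewrite mulr0 addr0].
rewrite -[RHS]mul1r -detU -det_mulmx; congr (\det _).
apply/matrixP => c j; rewrite !mxE.
pose G (k : nat) := x j ^+ (n.-1 - k) * hom2 k.+1 v (x j * - (w + u * x j)).
transitivity (\sum_(k < n) ((val k == val c)%:R * G k +
   (if val c is b.+1 then w * ((val k == b)%:R * G k) else 0) +
   (if val c is b.+2 then u * v * ((val k == b)%:R * G k) else 0))); last first.
  apply: eq_bigr => k _; rewrite !mxE /= -/(G k) !mulrDl; congr (_ + _ + _).
    by case: (nat_of_ord c) => [|b]; rewrite ?mul0r // mulrA.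
  by case: (nat_of_ord c) => [|[|b]]; rewrite ?mul0r // mulrA.
rewrite !big_split /= sum_pick ltn_ord hookrowE // -/(G c).
congr (_ + _ + _).
  case E: (nat_of_ord c) => [|b]; first by rewrite big1.
  by rewrite -mulr_sumr sum_pick ltnW // -E ltn_ord.
case E: (nat_of_ord c) => [|[|b]]; try by rewrite big1.
rewrite -mulr_sumr sum_pick; case: ifP => // /negP []; have := ltn_ord c; lia.
Qed.

(** * Chains of interlacing strict partitions *)

(** Padding with zeros beyond n gives a meaning to conditions on consecutive parts at the last
    index. *)
Definition lv n N (f : {ffun 'I_n -> 'I_N}) (i : nat) : nat :=
  if insub i is Some k then val (f k) else 0%N.

Lemma lv_ord n N (f : {ffun 'I_n -> 'I_N}) (i : 'I_n) : lv f i = f i.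
Proof. by rewrite /lv valK. Qed.

Lemma lv_out n N (f : {ffun 'I_n -> 'I_N}) i : (n <= i)%N -> lv f i = 0%N.
Proof. by move=> ni; rewrite /lv insubN // -leqNgt. Qed.

Lemma lv_gt0 n N (f : {ffun 'I_n -> 'I_N}) i : (0 < lv f i)%N -> (i < n)%N.
Proof. by case: (ltnP i n) => // ni; rewrite lv_out. Qed.

Lemma lv_inj n N (f g : {ffun 'I_n -> 'I_N}) : lv f =1 lv g -> f = g.
Proof. by move=> fg; apply/ffunP => i; apply: ord_inj; rewrite -!lv_ord. Qed.

Lemma lv_lt n N (f : {ffun 'I_n -> 'I_N.+1}) i : (lv f i < N.+1)%N.
Proof. by rewrite /lv; case: insubP => [k _ _|_] /=; rewrite ?ltn_ord. Qed.

Definition mkl n N (f : nat -> nat) : {ffun 'I_n -> 'I_N.+1} := [ffun i : 'I_n => inord (f i)].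

Lemma lv_mkl n N f i : (f i <= N)%N -> ((n <= i)%N -> f i = 0%N) -> lv (mkl n N f) i = f i.
Proof.
move=> fN fn; case: (ltnP i n) => ni; last by rewrite lv_out // fn.
by rewrite (lv_ord _ (Ordinal ni)) ffunE inordK.
Qed.

(** The truncated predecessor allows a zero to be followed by zeros only: a strict partition padded
    with zeros. *)
Definition strict n N (g : {ffun 'I_n -> 'I_N}) : bool :=
  [forall i : 'I_n, lv g i.+1 <= (lv g i).-1]%N.

Lemma strictP n N (g : {ffun 'I_n -> 'I_N}) :
  reflect (forall i, lv g i.+1 <= (lv g i).-1)%N (strict g).
Proof.
apply: (iffP forallP) => H i //.
by case: (ltnP i n) => ni; [exact: (H (Ordinal ni)) | rewrite !lv_out // ltnW].
Qed.

(** The interval allowed for [lv h i] is the range of summation in [geo_split], with q the next part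
    of g and p the current one. *)
Definition below n N (g h : {ffun 'I_n -> 'I_N}) : bool :=
  [forall i : 'I_n, if (0 < lv g i)%N then (lv g i.+1 <= lv h i < lv g i)%N
                    else lv h i == 0%N].

Lemma belowP n N (g h : {ffun 'I_n -> 'I_N}) :
  reflect (forall i, if (0 < lv g i)%N then (lv g i.+1 <= lv h i < lv g i)%N
                     else lv h i == 0%N) (below g h).
Proof.
apply: (iffP forallP) => H i //.
by case: (ltnP i n) => ni; [exact: (H (Ordinal ni)) | rewrite (lv_out g ni) (lv_out h ni)].
Qed.

Lemma below_strict n N (g h : {ffun 'I_n -> 'I_N}) : strict g -> below g h -> strict h.
Proof.
move=> /strictP sg /belowP gh; apply/strictP => i.
by have := sg i; move: (gh i) (gh i.+1); case: ifP => ?; case: ifP => ?; lia.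
Qed.

Section ChainExpand.
Variables (R : comNzRingType) (w : R).

(** Telescoping: since z = w + t, the difference Z (s + 1) - w Z s is t z^(s-1) for s > 0, and it is
    1 for s = 0 because Z 0 = 0. *)
Lemma geo_split (z t : R) q p : z = w + t -> (q <= p)%N ->
  let Z p := if p is b.+1 then z ^+ b else 0 in
  Z p - w ^+ (p - q) * Z q =
  \sum_(q <= s < p) w ^+ (p.-1 - s) * (if s is b.+1 then t * z ^+ b else 1).
Proof.
move=> zE qp Z; rewrite -(subnKC qp); elim: (p - q)%N => [|d IHd].
  by rewrite addn0 subnn mul1r subrr big_geq.
rewrite addnS big_nat_recr ?leq_addr //= subnn mul1r.
have -> : \sum_(q <= i < q + d) w ^+ (q + d - i) * (if i is b.+1 then t * z ^+ b else 1) =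
   w * \sum_(q <= s < q + d) w ^+ ((q + d).-1 - s) * (if s is b.+1 then t * z ^+ b else 1).
  rewrite mulr_sumr; apply: eq_big_nat => i iqd; rewrite mulrA -exprS.
  by congr (_ ^+ _ * _); lia.
rewrite -IHd subSn ?leq_addr // !addKn exprS /Z.
by case: (q + d)%N => [|b]; rewrite ?exprS zE; ring.
Qed.

Variables (n N : nat) (t : 'I_n -> R).
Implicit Types (g h : {ffun 'I_n -> 'I_N.+1}) (y : 'I_n -> R) (rho : 'I_n -> 'I_n -> R).

Definition layer_mx g y rho : 'M[R]_n :=
  \matrix_(i, j) if lv g i is b.+1 then y j * (w + t j) ^+ b else rho i j.

(** Subtracting w^(g_i - g_(i+1)) times row i + 1 from row i turns each row with a positive part
    into the sum of [geo_split]. Choosing the summand s = h_i > 0 multiplies [y] by [t] in that row;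
    choosing s = 0 freezes the row at [y]. *)
Lemma layer_step g y rho : strict g ->
  \det (layer_mx g y rho) =
  \sum_(h : {ffun 'I_n -> 'I_N.+1} | below g h)
    (\prod_(i < n | (0 < lv g i)%N) w ^+ ((lv g i).-1 - lv h i)) *
    \det (layer_mx h (fun j => y j * t j)
            (fun i j => if (0 < lv g i)%N then y j else rho i j)).
Proof.
move=> /strictP sg.
pose U : 'M[R]_n := \matrix_(i, k) ((val k == val i)%:R -
  (if (0 < lv g i.+1)%N then w ^+ (lv g i - lv g i.+1) else 0) * (val k == i.+1)%:R).
have detU : \det U = 1.
  apply: det_unitrig => [i|i j ij]; rewrite mxE.
    by rewrite eqxx (ltn_eqF (ltnSn i)) mulr0 subr0.
  by rewrite (ltn_eqF ij) (ltn_eqF (ltnW _)) ?mulr0 ?subr0 // ltnS.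
pose C (i : 'I_n) (s : 'I_N.+1) : R :=
  if (0 < lv g i)%N then (lv g i.+1 <= s < lv g i)%N%:R * w ^+ ((lv g i).-1 - s)
  else (s == 0%N :> nat)%:R.
pose eta (i : 'I_n) (s : 'I_N.+1) (j : 'I_n) : R :=
  if nat_of_ord s is b.+1 then y j * t j * (w + t j) ^+ b
  else if (0 < lv g i)%N then y j else rho i j.
transitivity (\det (\matrix_(i, j) \sum_s C i s * eta i s j)).
  rewrite -[LHS]mul1r -detU -det_mulmx; congr (\det _); apply/matrixP => i j.
  rewrite !mxE.
  pose M (k : nat) := if insub k is Some k' then layer_mx g y rho k' j else 0.
  have ME (k : 'I_n) : layer_mx g y rho k j = M k by rewrite /M valK.
  under eq_bigr => k _ do rewrite ME mxE mulrBl -mulrA.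
  rewrite sumrB -mulr_sumr !sum_pick ltn_ord -ME mxE.
  have -> : (if (0 < lv g i.+1)%N then w ^+ (lv g i - lv g i.+1) else 0) *
      (if (i.+1 < n)%N then M i.+1 else 0) =
      y j * (w ^+ (lv g i - lv g i.+1) *
             (if lv g i.+1 is b.+1 then (w + t j) ^+ b else 0)).
    case: (ltnP 0 (lv g i.+1)) => [g1|]; last first.
      by rewrite leqn0 => /eqP->; rewrite mul0r !mulr0.
    have iSn := lv_gt0 g1; rewrite iSn (_ : i.+1 = Ordinal iSn) // -ME mxE.
    by case: (lv g (Ordinal iSn)) g1 => // b _; rewrite mulrCA.
  case: (posnP (lv g i)) => [g0|g0].
    have := sg i; rewrite g0 leqn0 => /eqP ->; rewrite !mulr0 subr0 /C /eta g0 /=.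
    rewrite (bigD1 ord0) //= mul1r big1 ?addr0 // => s /eqP s0.
    by case: eqP => [E|_]; [case: s0; apply: val_inj | rewrite mul0r].
  have -> : (if lv g i is b.+1 then y j * (w + t j) ^+ b else rho i j) =
     y j * (if lv g i is b.+1 then (w + t j) ^+ b else 0) by case: (lv g i) g0.
  rewrite -mulrBr (@geo_split _ (t j)) //; last by have := sg i; lia.
  rewrite mulr_sumr /C /eta g0.
  rewrite (big_nat_widen _ _ _ _ _ (ltnW (lv_lt g i))).
  rewrite (big_nat_widenl _ _ _ _ _ (leq0n _)) big_mkord.
  rewrite big_mkcond; apply: eq_bigr => s _ /=.
  rewrite andbC; case: ifP => _; rewrite ?mul0r // mul1r.
  by case: (nat_of_ord s) => [|b]; ring.
(* A choice of summands outside the interlacing range has a zero coefficient. *)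
rewrite det_expand (bigID (below g)) /= [X in _ + X]big1 ?addr0; last first.
  move=> f /forallPn [i]; rewrite /= => Hi; rewrite (bigD1 i) //=.
  by rewrite /C -lv_ord; case: ifP Hi => _ /negPf ->; rewrite !mul0r.
apply: eq_bigr => f /belowP gf; congr (_ * _); last congr (\det _).
  rewrite [RHS]big_mkcond; apply: eq_bigr => i _; rewrite /C -lv_ord.
  by have := gf i; case: ifP => _ ->; rewrite ?mul1r.
by apply/matrixP => i j; rewrite !mxE /eta (lv_ord f i).
Qed.

Definition tuple_cons (T : Type) K (p : T * K.-tuple T) : K.+1.-tuple T := [tuple of p.1 :: p.2].

Lemma big_tuple_path (T : finType) (e : rel T) K (x : T) (F : K.+1.-tuple T -> R) :
  \sum_(c : K.+1.-tuple T | path e x c) F c =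
  \sum_(h | e x h) \sum_(c : K.-tuple T | path e h c) F [tuple of h :: c].
Proof.
rewrite pair_big_dep /= (reindex (@tuple_cons T K)) //=.
exists (fun c : K.+1.-tuple T => (thead c, [tuple of behead c])) => [[h c] _|c _] /=.
  by congr pair; apply: val_inj.
by rewrite [RHS]tuple_eta; apply: val_inj.
Qed.

(** Along a chain a zero part stays zero, so this is the number of further steps that the i-th part
    survives. *)
Definition height (c : seq {ffun 'I_n -> 'I_N.+1}) i := count (fun h => 0 < lv h i)%N c.

Lemma height0 g c i : path (@below n N.+1) g c -> lv g i = 0%N -> height c i = 0%N.
Proof.
elim: c g => //= h c IHc g /andP [/belowP /(_ i) gh hc] g0.
by move: gh; rewrite g0 => /eqP h0; rewrite h0 (IHc h).
Qed.

Lemma height_le g c i : path (@below n N.+1) g c -> (height c i <= (lv g i).-1)%N.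
Proof.
elim: c g => //= h c IHc g /andP [/belowP /(_ i) gh hc].
by have := IHc _ hc; rewrite -/(height c i); move: gh; case: ifP; lia.
Qed.

(** Positive parts drop at every step, so K steps exhaust parts of size at most K. A part g_i loses
    one unit at each of [height c i + 1] steps, and the rest of g_i is the total exponent of w. Its
    row is frozen after [height c i] multiplications by [t]. *)
Lemma chain_expand K g y rho : strict g -> (forall i, lv g i <= K)%N ->
  \det (layer_mx g y rho) =
  \sum_(c : K.-tuple {ffun 'I_n -> 'I_N.+1} | path (@below n N.+1) g c)
    (\prod_(i < n | (0 < lv g i)%N) w ^+ ((lv g i).-1 - height c i)) *
    \det (\matrix_(i, j) if (0 < lv g i)%N then y j * t j ^+ height c i else rho i j).
Proof.
elim: K g y rho => [|K IHK] g y rho sg gK.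
  have g0 i : lv g i = 0%N by have := gK i; lia.
  rewrite (big_pred1 [tuple]) => [|c]; last by rewrite tuple0 /= eqxx.
  rewrite big_pred0 => [|i]; last by rewrite g0.
  by rewrite mul1r; congr (\det _); apply/matrixP => i j; rewrite !mxE g0.
rewrite big_tuple_path layer_step //; apply: eq_bigr => h gh.
have sh := below_strict sg gh; move/belowP: (gh) => ghP.
rewrite IHK //; last by move=> i; have := gK i; have := ghP i; case: ifP; lia.
rewrite mulr_sumr; apply: eq_bigr => c hc; rewrite mulrA; congr (_ * _); last congr (\det _).
  rewrite [X in _ * X]big_mkcond [X in X * _]big_mkcond [RHS]big_mkcond -big_split /=.
  apply: eq_bigr => i _; rewrite -/(height c i); have := height_le i hc.
  have := ghP i; case: (posnP (lv g i)) => [g0 /eqP -> //=|g0]; first by rewrite mulr1.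
  case: (posnP (lv h i)) => [-> _|h0]; first by rewrite /= leqn0 mulr1 => /eqP ->; rewrite subn0.
  by rewrite -exprD => Hh Hc; congr (_ ^+ _); lia.
apply/matrixP => i j; rewrite !mxE /= -/(height c i).
have := ghP i; case: (posnP (lv g i)) => [g0 /eqP -> //=|g0].
case: (posnP (lv h i)) => [h0 _|h0 _]; first by rewrite (height0 hc h0) mulr1.
by rewrite /= add1n exprS mulrA.
Qed.

End ChainExpand.

(** * Jacobi-Trudi determinants *)

Section JacobiTrudi.
Variables (R : comNzRingType) (x : nat -> R).

(** The complete homogeneous polynomial of degree a in x 0, ..., x (K - 1), expanded by powers of
    the last variable. *)
Fixpoint hc (K a : nat) : R :=
  if K is K'.+1 then \sum_(s < a.+1) x K' ^+ (a - s) * hc K' s else (a == 0%N)%:R.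

Lemma hc0 K : hc K 0 = 1.
Proof. by elim: K => //= K IHK; rewrite big_ord1 subnn mul1r. Qed.

Lemma hcS K a : hc K.+1 a.+1 = x K * hc K.+1 a + hc K a.+1.
Proof.
rewrite /= big_ord_recr /= subnn mul1r mulr_sumr; congr (_ + _).
by apply: eq_bigr => s _; rewrite mulrA -exprS subSn // -ltnS.
Qed.

Local Arguments hc : simpl never.

(** Jacobi-Trudi entry of degree l + j - i; the test keeps negative degrees from being truncated to
    0. *)
Definition hd (K l i j : nat) : R := if (i <= l + j)%N then hc K (l + j - i) else 0.

Lemma hdS K l i j : hd K.+1 l i j = x K * hd K.+1 l i.+1 j + hd K l i j.
Proof.
rewrite /hd; case: (ltngtP i (l + j)) => [ilj|ilj|<-]; last 2 first.
- by rewrite mulr0 addr0.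
- by rewrite subnn !hc0 mulr0 add0r.
by rewrite -[(l + j - i)%N]prednK ?subn_gt0 // hcS -subnS.
Qed.

Lemma hdSS K l i j : hd K l.+1 i.+1 j = hd K l i j.
Proof. by rewrite /hd addSn subSS. Qed.

(** The telescoping of [geo_split], now driven by [hdS]: a factor x_K compensates for a degree
    lowered by one. *)
Lemma hd_split K i j q p : (q <= p)%N ->
  hd K.+1 p i j - x K ^+ (p - q).+1 * hd K.+1 q i.+1 j =
  \sum_(q <= s < p.+1) x K ^+ (p - s) * hd K s i j.
Proof.
move=> qp; rewrite -(subnKC qp); elim: (p - q)%N => [|d IHd].
  by rewrite addn0 subnn big_nat1 subnn mul1r expr1 hdS addrC addKr.
rewrite addnS big_nat_recr ?leqW ?leq_addr //= subnn mul1r.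
have -> : \sum_(q <= s < (q + d).+1) x K ^+ ((q + d).+1 - s) * hd K s i j =
   x K * \sum_(q <= s < (q + d).+1) x K ^+ (q + d - s) * hd K s i j.
  rewrite mulr_sumr; apply: eq_big_nat => s /andP[_ sd]; rewrite mulrA -exprS.
  by rewrite subSn.
by rewrite -IHd subSn ?leq_addr // !addKn hdS hdSS exprS; ring.
Qed.

Definition jacobi_trudi n K (l : nat -> nat) : R :=
  \det (\matrix_(i < n, j < n) hd K (l i) i j).

Lemma jacobi_trudi0 n l :
  jacobi_trudi n 0 l = [forall i : 'I_n, l i == 0%N]%:R.
Proof.
rewrite /jacobi_trudi det_trig; last first.
  apply/is_trig_mxP => i j ij; rewrite mxE /hd; case: ifP => //= _.
  by rewrite /hc; case: eqP => //; lia.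
case: forallP => [l0|/forallP]; rewrite ?negb_forall.
  by apply: big1 => i _; rewrite mxE /hd (eqP (l0 i)) leqnn subnn.
case/existsP => i li; rewrite (bigD1 i) //= mxE /hd leq_addl addnK /hc.
by rewrite (negPf li) mul0r.
Qed.

Definition interlace n N (l : nat -> nat) (mu : {ffun 'I_n -> 'I_N}) : bool :=
  [forall i : 'I_n, l i.+1 <= lv mu i <= l i]%N.

(** Row i minus a power of x_K times row i + 1 is the sum of [hd_split], where s runs over the
    interlacing range: the branching rule for the last variable. *)
Lemma jacobi_trudiS n N K (l : nat -> nat) :
    (forall i, l i.+1 <= l i <= N)%N -> l n = 0%N ->
  jacobi_trudi n K.+1 l =
  \sum_(mu : {ffun 'I_n -> 'I_N.+1} | interlace l mu)
     (\prod_(i < n) x K ^+ (l i - lv mu i)) * jacobi_trudi n K (lv mu).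
Proof.
move=> lP ln.
pose U : 'M[R]_n := \matrix_(i, k) ((val k == val i)%:R -
  x K ^+ (l i - l i.+1).+1 * (val k == i.+1)%:R).
have detU : \det U = 1.
  apply: det_unitrig => [i|i j ij]; rewrite mxE.
    by rewrite eqxx (ltn_eqF (ltnSn i)) mulr0 subr0.
  by rewrite (ltn_eqF ij) (ltn_eqF (ltnW _)) ?mulr0 ?subr0 // ltnS.
pose C (i : 'I_n) (s : 'I_N.+1) : R :=
  (l i.+1 <= s <= l i)%N%:R * x K ^+ (l i - s).
pose eta (i : 'I_n) (s : 'I_N.+1) (j : 'I_n) : R := hd K s i j.
transitivity (\det (\matrix_(i, j) \sum_s C i s * eta i s j)).
  rewrite -[LHS]mul1r -detU -det_mulmx; congr (\det _); apply/matrixP => i j.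
  rewrite !mxE.
  pose M (k : nat) := hd K.+1 (l k) k j.
  under eq_bigr => k _ do rewrite mxE [X in _ * X]mxE -/(M k) mulrBl -mulrA.
  rewrite sumrB -mulr_sumr !sum_pick ltn_ord.
  (* The last row has no successor, but with [l n = 0] a fictitious row n would have entries of
     negative degree j - n, hence zero. *)
  have -> : (if (i.+1 < n)%N then M i.+1 else 0) = hd K.+1 (l i.+1) i.+1 j.
    case: ifP => // /negP; rewrite /M => iSn.
    have -> : i.+1 = n by have := ltn_ord i; lia.
    by rewrite ln /hd add0n leqNgt ltn_ord.
  have /andP[li1 liN] := lP i.
  rewrite /M hd_split //.
  rewrite (big_nat_widen _ _ N.+1) ?ltnS // (big_nat_widenl _ _ _ _ _ (leq0n _)) big_mkord.
  rewrite big_mkcond; apply: eq_bigr => s _ /=; rewrite /C /eta andbC ltnS.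
  by case: ifP; rewrite ?mul0r ?mul1r.
rewrite det_expand (bigID (interlace l)) /= [X in _ + X]big1 ?addr0; last first.
  move=> f /forallPn [i] /= Hi; rewrite (bigD1 i) //=.
  by rewrite /C -lv_ord (negPf Hi) !mul0r.
apply: eq_bigr => f /forallP lf; congr (_ * _); last congr (\det _).
  by apply: eq_bigr => i _; rewrite /C -lv_ord lf mul1r.
by apply/matrixP => i j; rewrite !mxE /eta lv_ord.
Qed.

(** The generating series of the complete homogeneous polynomials inverts the product of the 1 - x_i
    X; truncation leaves a multiple of X^(M+1). *)
Lemma hc_gen M K : exists r : {poly R},
  (\poly_(a < M.+1) hc K a) * \prod_(i < K) (1 - x i *: 'X) = 1 + 'X^(M.+1) * r.
Proof.
elim: K => [|K [r IHK]].
  exists 0; rewrite big_ord0 mulr1 mulr0 addr0; apply/polyP => a.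
  by rewrite coef_poly coef1; case: ltnP => //; case: a.
exists (r - (x K * hc K.+1 M) *: \prod_(i < K) (1 - x i *: 'X)).
rewrite big_ord_recr /= [_ * (1 - _)]mulrC mulrA.
have -> : \poly_(a < M.+1) hc K.+1 a * (1 - x K *: 'X) =
   \poly_(a < M.+1) hc K a - (x K * hc K.+1 M) *: 'X^(M.+1).
  apply/polyP => -[|a]; rewrite mulrBr mulr1 -scalerAr.
    rewrite !(coefB, coefZ, coef_poly, coefMX, coefXn).
    by rewrite !hc0 /= !mulr0.
  rewrite !(coefB, coefZ, coef_poly, coefMX, coefXn) eqSS /=.
  case: (ltngtP a M) => aM.
  - by rewrite !ltnS aM (ltnW aM) mulr0 subr0 hcS; ring.
  - by rewrite !ltnS (ltnNge a M) (leqNgt a M) aM (ltnW aM) !mulr0.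
  by rewrite !ltnS aM leqnn ltnn mulr1.
by rewrite mulrBl IHK -scalerAl mulrBr -scalerAr addrA.
Qed.

Lemma geom_gen M (y : R) :
  (\poly_(a < M.+1) y ^+ a) * (1 - y *: 'X) = 1 - (y ^+ M.+1) *: 'X^(M.+1).
Proof.
apply/polyP => -[|a]; rewrite mulrBr mulr1 -scalerAr.
  by rewrite !(coefB, coefZ, coef_poly, coefMX, coefXn, coef1) !mulr0.
rewrite !(coefB, coefZ, coef_poly, coefMX, coefXn, coef1) !eqSS /=.
case: (ltngtP a M) => aM.
- by rewrite !ltnS aM (ltnW aM) mulr0 -exprS subrr subr0.
- by rewrite !ltnS (ltnNge a M) (leqNgt a M) aM (ltnW aM) !mulr0.
by rewrite !ltnS aM leqnn ltnn mulr1 -exprS.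
Qed.

(** The series 1 / (1 - x_l X) is the product of the 1 - x_i X over i != l, times the generating
    series of the h_a. That product is q, which has degree below n and does not depend on k. *)
Lemma hc_power n (l : 'I_n) : exists2 q : {poly R}, (size q <= n)%N &
  forall k, x l ^+ k = \sum_(a < n | (a <= k)%N) q`_a * hc n (k - a).
Proof.
pose q : {poly R} := \prod_(i < n | i != l) (1 - x i *: 'X).
have sq : (size q <= n)%N.
  rewrite (leq_trans (size_poly_prod_leq _ _)) //.
  rewrite leq_subLR (@leq_ltn_trans (\sum_(i < n | i != l) 2)) //.
    apply: leq_sum => i _; rewrite (leq_trans (size_polyD _ _)) // geq_max size_poly1 /=.
    by rewrite size_polyN (leq_trans (size_scale_leq _ _)) // size_polyX.
  rewrite sum_nat_const cardC1 card_ord; have := ltn_ord l; lia.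
exists q => // k.
pose H := \poly_(a < k.+1) hc n a; pose G := \poly_(a < k.+1) x l ^+ a.
have [r Hr] := hc_gen k n.
(* An identity modulo X^(k+1) stands in for power series; the error does not reach the coefficient
   of index k. *)
have E : q * H = G + 'X^(k.+1) * (G * r + (x l ^+ k.+1) *: (q * H)).
  have : G * (\prod_(i < n) (1 - x i *: 'X) * H) = G * (1 + 'X^(k.+1) * r).
    by rewrite -Hr [H * _]mulrC.
  rewrite (bigD1 l) //= -/q !mulrA /G geom_gen -/G !mulrBl mul1r => /eqP.
  rewrite subr_eq => /eqP E; rewrite [LHS]E.
  rewrite -!scalerAl !mulrDr mulr1 -scalerAr !mulrA -!addrA.
  by congr (_ + (_ * _ + _)); rewrite mulrC.
have := congr1 (fun p : {poly R} => p`_k) E.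
rewrite /= coefD coefXnM ltnSn addr0 coef_poly ltnSn => <-.
rewrite coefM (big_ord_widen_cond (maxn n k.+1) xpredT (fun a => q`_a * H`_(k - a))) ?leq_maxr //.
rewrite [RHS](big_ord_widen_cond (maxn n k.+1) (fun a => a <= k)%N
   (fun a => q`_a * hc n (k - a))) ?leq_maxl //.
rewrite big_mkcond [RHS]big_mkcond; apply: eq_bigr => a _ /=; rewrite ltnS.
case: (leqP a k) => //= ak; rewrite coef_poly ltnS leq_subr.
by case: ltnP => // na; rewrite nth_default ?mul0r // (leq_trans sq).
Qed.

(** By [hc_power] the alternant matrix is the Jacobi-Trudi matrix times a matrix [E] independent of
    l. At l = 0 the Jacobi-Trudi matrix is unitriangular, which identifies the determinant of
    [E]. *)
Lemma alternantE n (l : nat -> nat) :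
  \det (\matrix_(i < n, j < n) x j ^+ (l i + (n.-1 - i))) =
  \det (\matrix_(i < n, j < n) x j ^+ (n.-1 - i)) * jacobi_trudi n n l.
Proof.
have [q qP] : exists q : 'I_n -> {poly R}, forall j k,
    x (val j) ^+ k = \sum_(a < n | (a <= k)%N) (q j)`_a * hc n (k - a).
  have /fin_all_exists [q qP] : forall j : 'I_n, exists q : {poly R}, forall k,
    x (val j) ^+ k = \sum_(a < n | (a <= k)%N) q`_a * hc n (k - a).
    by move=> j; have [q _ qP] := hc_power j; exists q.
  by exists q.
pose E : 'M[R]_n := \matrix_(k, j) (q j)`_(n.-1 - k).
have altE (m : nat -> nat) :
  \det (\matrix_(i < n, j < n) x j ^+ (m i + (n.-1 - i))) = jacobi_trudi n n m * \det E.
  rewrite /jacobi_trudi -det_mulmx; congr (\det _); apply/matrixP => i j; rewrite !mxE qP.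
  rewrite (reindex_inj rev_ord_inj) big_mkcond; apply: eq_bigr => k _; rewrite !mxE /=.
  have kn := ltn_ord k; have li := ltn_ord i.
  rewrite /hd (_ : (n - k.+1 <= m i + (n.-1 - i)) = (i <= m i + k))%N; last by lia.
  case: ifP => ik; last by rewrite mul0r.
  by rewrite mulrC; congr (hc _ _ * _`_ _); lia.
rewrite altE mulrC; congr (_ * _).
have := altE (fun=> 0%N); rewrite (_ : jacobi_trudi n n (fun=> 0%N) = 1) ?mul1r; last first.
  apply: det_unitrig => [i|i j ij]; rewrite mxE /hd add0n.
    by rewrite leqnn subnn hc0.
  by rewrite leqNgt ij.
by move=> <-.
Qed.

End JacobiTrudi.

(** * Semistandard tableaux *)

(** A downward closed predicate holds exactly on an initial segment, whose length is the count. *)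
Lemma count_downset (p : pred nat) m j : (forall j, p j.+1 -> p j) -> (j < m)%N ->
  (j < count p (iota 0 m))%N = p j.
Proof.
move=> pd jm; have pd' i k : (i <= k)%N -> p k -> p i.
  by move=> ik; rewrite -(subnKC ik); elim: (k - i)%N => [|d IHd]; rewrite ?addn0 // addnS => /pd.
have -> : m = (j + (m - j))%N by lia.
rewrite iotaD count_cat add0n; case: (boolP (p j)) => pj.
  have -> : (m - j)%N = (m - j).-1.+1 by lia.
  rewrite /= pj (_ : count p (iota 0 j) = j); first by lia.
  rewrite -[RHS](size_iota 0); apply/eqP; rewrite -all_count; apply/allP => i.
  by rewrite mem_iota => /andP[_ ij]; apply: pd' pj; apply: ltnW.
rewrite (_ : count p (iota j (m - j)) = 0%N).
  by rewrite addn0; apply/negbTE; rewrite -leqNgt -[X in (_ <= X)%N](size_iota 0) count_size.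
apply/eqP; rewrite -leqn0 leqNgt -has_count; apply/hasPn => k.
by rewrite mem_iota => /andP[jk _]; apply: contraNN pj; apply: pd'.
Qed.

Section Tableaux.
Variables (R : comNzRingType) (x : nat -> R) (n' r s : nat).
Local Notation n := n'.+1.
Local Notation filling := {ffun 'I_r * 'I_s -> 'I_n}.
Implicit Types (t : filling) (l : nat -> nat).

(** The bound K on the entries is the induction parameter: erasing the largest letter passes from K
    + 1 to K. *)
Definition ssyt_lt K l t : bool :=
  [forall c : 'I_r * 'I_s, if (c.2 < l c.1)%N then (t c < K)%N else val (t c) == 0%N] &&
  [forall c1 : 'I_r * 'I_s, forall c2 : 'I_r * 'I_s,
     ((c1.2 < l c1.1) && (c2.2 < l c2.1))%N ==>
     ((((c1.1 == c2.1) && (c1.2 < c2.2)%N) ==> (t c1 <= t c2)%N) &&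
      (((c1.2 == c2.2) && (c1.1 < c2.1)%N) ==> (t c1 < t c2)%N))].

Lemma ssyt_ltP K l t :
  reflect [/\ forall (i : 'I_r) (j : 'I_s), (j < l i)%N -> (t (i, j) < K)%N,
              forall (i : 'I_r) (j : 'I_s), (l i <= j)%N -> t (i, j) = 0%N :> nat,
              forall (i : 'I_r) (j j' : 'I_s), (j < j')%N -> (j' < l i)%N ->
                (t (i, j) <= t (i, j'))%N
            & forall (i i' : 'I_r) (j : 'I_s), (i < i')%N -> (j < l i)%N -> (j < l i')%N ->
                (t (i, j) < t (i', j))%N]
          (ssyt_lt K l t).
Proof.
apply: (iffP andP) => [[/forallP H1 /forallP H2]|[H1 H2 H3 H4]]; split.
- by move=> i j ij; have := H1 (i, j); rewrite /= ij.
- by move=> i j ij; have := H1 (i, j); rewrite /= ltnNge ij => /eqP.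
- move=> i j j' jj' j'l; have /forallP/(_ (i, j')) := H2 (i, j).
  by rewrite /= j'l (ltn_trans jj' j'l) eqxx jj' /= => /andP[].
- move=> i i' j ii' jl jl'; have /forallP/(_ (i', j)) := H2 (i, j).
  by rewrite /= jl jl' eqxx ii' /= => /andP[].
- by apply/forallP => -[i j] /=; case: ltnP => ij; [apply: H1 | rewrite H2].
apply/forallP => -[i1 j1]; apply/forallP => -[i2 j2] /=.
apply/implyP => /andP[l1 l2]; apply/andP; split; apply/implyP => /andP[/eqP E lt].
  by subst i2; apply: H3.
by subst j2; apply: H4.
Qed.

Definition ssyt_sum K l : R :=
  \sum_(t : filling | ssyt_lt K l t) \prod_(c : 'I_r * 'I_s | (c.2 < l c.1)%N) x (t c).

Definition tv t (i j : nat) : nat :=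
  if (insub i, insub j) is (Some i', Some j') then t (i', j') else 0%N.

Lemma tv_ord t (i : 'I_r) (j : 'I_s) : tv t i j = t (i, j).
Proof. by rewrite /tv !valK. Qed.

Definition subshape K l t (i : nat) : nat :=
  count (fun j => (j < l i) && (tv t i j < K))%N (iota 0 s).

Definition part_in l := (forall i, l i.+1 <= l i <= s)%N /\ (forall i, r <= i -> l i = 0)%N.

Lemma subshapeP K l t (i : 'I_r) (j : 'I_s) : part_in l -> ssyt_lt K.+1 l t ->
  (j < subshape K l t i)%N = (j < l i)%N && (t (i, j) < K)%N.
Proof.
move=> [lP _] /ssyt_ltP [_ _ Hrow _]; rewrite count_downset ?ltn_ord ?tv_ord //.
move=> k /andP[kl tk]; have /andP[_ ls] := lP i.
have ks : (k.+1 < s)%N by apply: leq_trans kl ls.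
rewrite (ltnW kl) /=; apply: leq_ltn_trans tk.
by rewrite (tv_ord t i (Ordinal (ltnW ks))) (tv_ord t i (Ordinal ks)); apply: Hrow.
Qed.

Lemma subshape_le K l t i : (subshape K l t i <= s)%N.
Proof. by rewrite -[X in (_ <= X)%N](size_iota 0) count_size. Qed.

Lemma subshape_out K l t i : part_in l -> (r <= i)%N -> subshape K l t i = 0%N.
Proof.
move=> [_ l0] ri; rewrite /subshape l0 //; by elim: (iota 0 s) => //= j q ->.
Qed.

Hypothesis rn : (r <= n)%N.

Definition sublayer K l t : {ffun 'I_n -> 'I_s.+1} := mkl n s (subshape K l t).

Lemma lv_sublayer K l t i : part_in l -> lv (sublayer K l t) i = subshape K l t i.
Proof.
move=> lP; rewrite lv_mkl ?subshape_le // => ni.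
by rewrite subshape_out // (leq_trans rn).
Qed.

Lemma interlace_part l (mu : {ffun 'I_n -> 'I_s.+1}) :
  part_in l -> interlace l mu -> part_in (lv mu).
Proof.
move=> [lP l0] /forallP lmu.
have lmu' i : (l i.+1 <= lv mu i <= l i)%N.
  case: (ltnP i n) => ni; first exact: (lmu (Ordinal ni)).
  by rewrite lv_out // !l0 //; lia.
split=> i; first by have := lmu' i; have := lmu' i.+1; have := lP i; lia.
by move=> ri; have := lmu' i; rewrite (l0 i) //; lia.
Qed.

(** Columns increase strictly, so a cell with a cell of l below it carries an entry less than K. The
    cells carrying K thus form a horizontal strip. *)
Lemma interlace_sublayer K l t : part_in l -> ssyt_lt K.+1 l t ->
  interlace l (sublayer K l t).
Proof.
move=> lPart tP; have [lP l0] := lPart; apply/forallP => i; rewrite lv_sublayer //.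
case: (ltnP i r) => ri; last by rewrite subshape_out // (l0 i.+1) // leqW.
have key := fun j => subshapeP (Ordinal ri) j lPart tP; rewrite /= in key.
have /ssyt_ltP [Hlt _ _ Hcol] := tP.
have /andP[li1 ls] := lP i; apply/andP; split; rewrite leqNgt; apply/negP => lt.
  have js : (subshape K l t i < s)%N by lia.
  have i1r : (i.+1 < r)%N.
    by case: (ltnP i.+1 r) => // ri1; move: lt; rewrite (l0 i.+1).
  have := key (Ordinal js); rewrite /= ltnn (leq_trans lt li1) /= => /esym/negP; apply.
  have := Hcol (Ordinal ri) (Ordinal i1r) (Ordinal js) (ltnSn _) (leq_trans lt li1) lt.
  by have := Hlt (Ordinal i1r) (Ordinal js) lt; lia.
have js : (l i < s)%N by have := subshape_le K l t i; lia.
by have := key (Ordinal js); rewrite /= lt ltnn.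
Qed.

Definition fill_up K l (mu : nat -> nat) t : filling :=
  [ffun c : 'I_r * 'I_s => if (mu c.1 <= c.2 < l c.1)%N then inord K else t c].
Definition fill_down (mu : nat -> nat) t : filling :=
  [ffun c : 'I_r * 'I_s => if (c.2 < mu c.1)%N then t c else ord0].

(** The left side is the condition that [reindex_onto] produces in [ssyt_sumS]. Its last clause
    forces t to vanish outside mu, as the normalization of [ssyt_lt] demands. *)
Lemma fill_upK K l (mu : {ffun 'I_n -> 'I_s.+1}) t : (K < n)%N ->
  part_in l -> interlace l mu ->
  [&& ssyt_lt K.+1 l (fill_up K l (lv mu) t),
      sublayer K l (fill_up K l (lv mu) t) == mu &
      fill_down (lv mu) (fill_up K l (lv mu) t) == t] = ssyt_lt K (lv mu) t.
Proof.
move=> Kn lPart lmu; have muPart := interlace_part lPart lmu.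
have lmu' (i : 'I_r) : (l i.+1 <= lv mu i <= l i)%N.
  exact: (forallP lmu (Ordinal (leq_trans (ltn_ord i) rn))).
have upin (i : 'I_r) (j : 'I_s) : (j < lv mu i)%N -> fill_up K l (lv mu) t (i, j) = t (i, j).
  by move=> jm; rewrite ffunE /= leqNgt jm.
have upK (i : 'I_r) (j : 'I_s) : (lv mu i <= j)%N -> (j < l i)%N ->
    fill_up K l (lv mu) t (i, j) = K :> nat.
  by move=> jm jl; rewrite ffunE /= jm jl inordK.
have upout (i : 'I_r) (j : 'I_s) : (l i <= j)%N -> fill_up K l (lv mu) t (i, j) = t (i, j).
  by move=> jl; rewrite ffunE /= [(j < _)%N]ltnNge jl andbF.
apply/and3P/idP => [[upP /eqP upmu /eqP updown]|tP].
  have /ssyt_ltP [H1 H2 H3 H4] := upP; apply/ssyt_ltP; split.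
  - move=> i j jm; rewrite -upin //.
    have := subshapeP i j lPart upP; rewrite -lv_sublayer // upmu jm.
    by move=> /esym/andP[].
  - by move=> i j jm; rewrite -updown ffunE /= ltnNge jm.
  - move=> i j j' jj' j'm; rewrite -!upin ?(ltn_trans jj') //; apply: H3 => //.
    by apply: leq_trans j'm _; have /andP[] := lmu' i.
  - move=> i i' j ii' jm jm'; rewrite -!upin //; apply: H4 => //.
      by apply: leq_trans jm _; have /andP[] := lmu' i.
    by apply: leq_trans jm' _; have /andP[] := lmu' i'.
have /ssyt_ltP [H1 H2 H3 H4] := tP.
have upP : ssyt_lt K.+1 l (fill_up K l (lv mu) t).
  apply/ssyt_ltP; split.
  - move=> i j jl; case: (ltnP j (lv mu i)) => jm; last by rewrite upK.
    by rewrite upin // ltnS ltnW // H1.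
  - by move=> i j jl; rewrite upout // H2 // (leq_trans _ jl) //; have /andP[] := lmu' i.
  - move=> i j j' jj' j'l; case: (ltnP j' (lv mu i)) => jm'.
      by rewrite !upin ?H3 // (ltn_trans jj').
    rewrite (upK _ j') //; case: (ltnP j (lv mu i)) => jm.
      by rewrite upin // ltnW // H1.
    by rewrite upK // (ltn_trans jj').
  - move=> i i' j ii' jl jl'.
    (* A cell of l strictly below (i, j) gives j < l i' <= l (i + 1) <= mu i, so the upper cell is
       never one of the new cells. *)
    have jm : (j < lv mu i)%N.
      apply: leq_trans jl' _; have /andP[+ _] := lmu' i; apply: leq_trans.
      rewrite -(subnKC ii'); elim: (_ - _)%N => [|d IHd]; first by rewrite addn0.
      by rewrite addnS; apply: leq_trans IHd; have /andP[] := lPart.1 (i.+1 + d)%N.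
    rewrite upin //; case: (ltnP j (lv mu i')) => jm'; first by rewrite upin // H4.
    by rewrite upK // H1.
split=> //.
  apply/eqP/lv_inj => i; rewrite lv_sublayer //.
  case: (ltnP i r) => ri; last by rewrite subshape_out // (muPart.2 _ ri).
  have key := fun j => subshapeP (Ordinal ri) j lPart upP; rewrite /= in key.
  have keyE (j : 'I_s) : (j < subshape K l (fill_up K l (lv mu) t) i)%N = (j < lv mu i)%N.
    rewrite key; case: (ltnP j (lv mu i)) => jm.
      rewrite upin // H1 // andbT; apply: leq_trans jm _.
      by have /andP[] := lmu' (Ordinal ri).
    by case: ltnP => // jl; rewrite upK // ltnn.
  have := subshape_le K l (fill_up K l (lv mu) t) i.
  have /andP[_ mus] := muPart.1 i.
  case: (ltngtP (subshape K l (fill_up K l (lv mu) t) i) (lv mu i)) => // lt lts.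
    by have := keyE (Ordinal (leq_trans lt mus)); rewrite /= lt ltnn.
  by have := keyE (Ordinal (leq_trans lt lts)); rewrite /= lt ltnn.
apply/eqP/ffunP => -[i j]; rewrite [LHS]ffunE /=; case: ltnP => jm; first by rewrite upin.
by apply: ord_inj; rewrite H2.
Qed.

Lemma fill_downK K l (mu : {ffun 'I_n -> 'I_s.+1}) t : (K < n)%N -> part_in l ->
  ssyt_lt K.+1 l t -> sublayer K l t = mu -> fill_up K l (lv mu) (fill_down (lv mu) t) = t.
Proof.
move=> Kn lPart tP tmu; apply/ffunP => -[i j]; rewrite !ffunE /=.
have /ssyt_ltP [H1 H2 _ _] := tP.
have := subshapeP i j lPart tP; rewrite -lv_sublayer // tmu.
case: (ltnP j (lv mu i)) => [jm /esym/andP[jl _]|jm] //=.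
case: (ltnP j (l i)) => [jl|jl _] /=; last by apply: ord_inj; rewrite H2.
move=> /esym/negbT; rewrite -leqNgt => Kt; apply: ord_inj; rewrite inordK //.
by have := H1 _ _ jl; lia.
Qed.

(** Tableaux are grouped by the shape mu of their entries below K; the erased cells all carry K, and
    row i has l i - mu i of them. *)
Lemma ssyt_sumS K l : (K < n)%N -> part_in l ->
  ssyt_sum K.+1 l = \sum_(mu : {ffun 'I_n -> 'I_s.+1} | interlace l mu)
     (\prod_(i < n) x K ^+ (l i - lv mu i)) * ssyt_sum K (lv mu).
Proof.
move=> Kn lPart; rewrite /ssyt_sum.
rewrite (partition_big (sublayer K l) (fun mu => interlace l mu)); last first.
  by move=> t; apply: interlace_sublayer.
apply: eq_bigr => mu lmu.
rewrite (reindex_onto (fill_up K l (lv mu)) (fill_down (lv mu))); last first.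
  by move=> t /andP[tP /eqP]; apply: fill_downK.
rewrite mulr_sumr; apply: eq_big => [t|t _]; first by rewrite -andbA fill_upK.
have lmu' (i : 'I_r) : (lv mu i <= l i)%N.
  have /forallP /(_ (Ordinal (leq_trans (ltn_ord i) rn))) := lmu.
  by move=> /andP[].
rewrite (bigID (fun c : 'I_r * 'I_s => c.2 < lv mu c.1)%N) /= mulrC; congr (_ * _).
  rewrite (eq_bigr (fun=> x K)); last first.
    by move=> [i j] /= /andP[jl]; rewrite -leqNgt => jm; rewrite ffunE /= jm jl inordK.
  rewrite -(pair_big_dep xpredT (fun (i : 'I_r) (j : 'I_s) => (j < l i) && ~~ (j < lv mu i))%N
    (fun _ _ => x K)) /=.
  rewrite [RHS](bigID (fun i : 'I_n => (i < r)%N)) /= [X in _ * X]big1 ?mulr1; last first.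
    by move=> i; rewrite -leqNgt => ri; rewrite lPart.2 // sub0n expr0.
  rewrite -(big_ord_widen n (fun i => x K ^+ (l i - lv mu i)) rn).
  apply: eq_bigr => i _; rewrite -prodr_const_nat.
  have /andP[_ ls] := lPart.1 i.
  rewrite (big_nat_widen _ _ _ _ _ ls) (big_nat_widenl _ _ _ _ _ (leq0n _)) big_mkord.
  by apply: eq_bigl => j; rewrite -leqNgt andbC.
apply: eq_big => [[i j]|[i j] /= /andP[_ jm]]; last first.
  by rewrite ffunE /= leqNgt jm.
by rewrite /= andbC; case: ltnP => //= jm; apply: leq_trans jm _.
Qed.

Lemma ssyt_sum0 l : part_in l ->
  ssyt_sum 0 l = [forall i : 'I_n, l i == 0%N]%:R.
Proof.
move=> lPart; rewrite /ssyt_sum; case: (boolP [forall i : 'I_n, l i == 0%N]) => [/forallP l0|].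
  have l0' (i : 'I_r) : l i = 0%N by apply/eqP/(l0 (Ordinal (leq_trans (ltn_ord i) rn))).
  rewrite (big_pred1 [ffun=> ord0]) => [|t].
    by rewrite big_pred0 // => -[i j]; rewrite /= l0'.
  apply/idP/eqP => [/ssyt_ltP[_ H _ _]|->].
    by apply/ffunP => -[i j]; rewrite ffunE; apply: ord_inj; rewrite H ?l0'.
  apply/ssyt_ltP; split=> [i j|i j|i j j' _|i i' j _]; rewrite ?ffunE ?l0' //.
case/forallPn => i li; rewrite big1 // => t /ssyt_ltP[H _ _ _].
have ri : (i < r)%N by rewrite ltnNge; apply: contra li => ri; rewrite lPart.2.
have s0 : (0 < s)%N.
  by apply: leq_trans (proj2 (andP (lPart.1 i))); rewrite lt0n.
by have := H (Ordinal ri) (Ordinal s0); rewrite /= lt0n => /(_ li).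
Qed.

(** Both sides obey the same branching rule and agree when there are no letters. *)
Lemma ssyt_jacobi_trudi K l : (K <= n)%N -> part_in l ->
  ssyt_sum K l = jacobi_trudi x n K l.
Proof.
elim: K l => [|K IHK] l Kn lPart; first by rewrite ssyt_sum0 ?jacobi_trudi0.
rewrite ssyt_sumS // (@jacobi_trudiS _ _ _ s) ?lPart.2 //; last exact: lPart.1.
apply: eq_bigr => mu lmu; rewrite IHK ?(ltnW Kn) //.
exact: interlace_part lmu.
Qed.

End Tableaux.

(** The bialternant formula, with Jacobi-Trudi determinants as intermediary between alternants and
    tableaux. *)
Lemma schur_alternant (R : comNzRingType) n (x : 'I_n -> {mpoly R[n]}) la :
  (0 < n)%N -> (size la <= n)%N -> sorted geq la -> (forall i, x i = 'X_i) ->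
  \det (\matrix_(i < n, j < n) x j ^+ (nth 0%N la i + (n.-1 - i))) =
  \det (\matrix_(i < n, j < n) x j ^+ (n.-1 - i)) * schur R n la.
Proof.
case: n x => // n' x _ sz srt xE.
pose X (k : nat) := x (inord k).
have XE (i : 'I_n'.+1) : x i = X i by rewrite /X inord_val.
under eq_mx => i j do rewrite XE.
under [X in _ = \det X * _]eq_mx => i j do rewrite XE.
rewrite alternantE; congr (_ * _).
rewrite -(@ssyt_jacobi_trudi _ _ _ (size la) (maxpart la)) //; last first.
  have lemax i : (nth 0%N la i <= maxpart la)%N.
    case: (ltnP i (size la)) => il; last by rewrite nth_default.
    by rewrite /maxpart; apply: (@leq_bigmax_seq _ la xpredT id) => //; apply: mem_nth.
  split=> i; last exact: nth_default.
  rewrite lemax andbT; case: (ltnP i.+1 (size la)) => il; last by rewrite nth_default.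
  by have := sorted_leq_nth (rev_trans leq_trans) leqnn 0%N srt; apply; rewrite ?inE // ltnW.
rewrite /ssyt_sum /schur; apply: eq_big => [t|t _]; last first.
  by apply: eq_bigr => c _; rewrite -XE xE.
rewrite /ssyt_lt /ssyt; congr (_ && _).
apply: eq_forallb => c; rewrite /in_shape; case: ifP => //= _.
by rewrite ltn_ord.
Qed.

(** * Expansion over row sets *)

Section SeqDet.
Variables (R : comNzRingType) (n : nat).
Implicit Types (p q : seq ('I_n -> R)) (a b : 'I_n -> R).

Definition seq_det p : R := \det (\matrix_(i < n, j < n) nth (fun=> 0) p i j).

Lemma seq_det_swap p a b q : (size p + (size q).+2 = n)%N ->
  seq_det (p ++ a :: b :: q) = - seq_det (p ++ b :: a :: q).
Proof.
move=> sz; have p0 : (size p < n)%N by lia.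
have p1 : ((size p).+1 < n)%N by lia.
pose i0 := Ordinal p0; pose i1 := Ordinal p1.
rewrite /seq_det -[RHS]mulN1r.
have -> : -1 = \det (perm_mx (tperm i0 i1)) :> R.
  by rewrite det_perm odd_tperm; case: eqP => // /(congr1 val) /=; lia.
rewrite -det_mulmx -row_permE; congr (\det _); apply/matrixP => i j; rewrite !mxE.
rewrite !nth_cat; case: tpermP => [->|->|/eqP ii0 /eqP ii1] /=.
- by rewrite ltnn subnn ltnNge leqnSn /= subSnn.
- by rewrite ltnn subnn ltnNge leqnSn /= subSnn.
case: ltnP => // pi; have : (nat_of_ord i != size p) by [].
have : (nat_of_ord i != (size p).+1) by [].
by move=> h1 h2; have -> : (i - size p = (i - size p).-2.+2)%N by lia.
Qed.

Lemma seq_det_move p a q : (size p + (size q).+1 = n)%N ->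
  seq_det (p ++ a :: q) = (-1) ^+ size p * seq_det (a :: p ++ q).
Proof.
elim/last_ind: p q => [|p b IHp] q sz; first by rewrite mul1r.
rewrite size_rcons in sz *; rewrite -cats1 -!catA /= seq_det_swap; last by lia.
by rewrite IHp /=; [rewrite exprS; ring | lia].
Qed.

(** Rows are treated in order. The rows before row k have only been permuted among themselves, so
    row k still has index k, and moving it to the front costs the sign (-1)^k. *)
Lemma seq_det_sort (f : pred nat) (row : nat -> 'I_n -> R) k : (k <= n)%N ->
  seq_det (map row (iota 0 n)) =
  (-1) ^+ (\sum_(c <- iota 0 k | f c) c)%N *
  seq_det (map row (rev (filter f (iota 0 k)) ++ filter (predC f) (iota 0 k) ++ iota k (n - k))).
Proof.
elim: k => [|k IHk] kn; first by rewrite big_nil mul1r subn0.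
rewrite IHk ?(ltnW kn) // -[in RHS]addn1 iotaD add0n /= !filter_cat /= big_cat big_cons big_nil /=.
rewrite (_ : (n - k = (n - k.+1).+1)%N) ?addn1; last by lia.
case: (boolP (f k)) => fk /=; last by rewrite addn0 cats0 -catA.
rewrite cats0 cats1 rev_rcons addn0 exprD -mulrA; congr (_ * _).
rewrite catA map_cat /= seq_det_move ?map_cat ?size_cat ?size_map ?size_rev.
  rewrite !size_filter count_predC size_iota -map_cat; congr (_ * seq_det _).
  by rewrite !map_cat /= catA.
by rewrite !size_filter count_predC !size_iota; lia.
Qed.

End SeqDet.

Lemma det_row_scale (R : comNzRingType) n (a : 'I_n -> R) (M : 'I_n -> 'I_n -> R) :
  \det (\matrix_(i, j) (a i * M i j)) = (\prod_i a i) * \det (\matrix_(i, j) M i j).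
Proof.
have -> : \prod_i a i = \det (diag_mx (\row_i a i)).
  by rewrite det_diag; apply: eq_bigr => i _; rewrite mxE.
by rewrite -det_mulmx mul_diag_mx; congr (\det _); apply/matrixP => i j; rewrite !mxE.
Qed.

Lemma nth_filter_pos (s : seq nat) i : sorted geq s ->
  nth 0%N (filter (leq 1) s) i = nth 0%N s i.
Proof.
elim: s i => //= a s IHs i srt.
have ss := path_sorted srt; case: a srt => [|a] srt /=; last by case: i => //= i; apply: IHs.
have s0 : all (pred1 0%N) s.
  elim: (s) srt => //= b s' IH /andP[]; rewrite leqn0 => /eqP -> /IH ->.
  by rewrite eqxx.
have -> : filter (leq 1) s = [::].
  by apply/eqP; rewrite -[_ == _]negbK -has_filter; apply/hasPn => b /(allP s0) /eqP ->.
rewrite nth_nil; case: i => //= i; case: (ltnP i (size s)) => ilt; last by rewrite nth_default.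
by rewrite (eqP (allP s0 _ (mem_nth 0%N ilt))).
Qed.

(** * Strict partitions as sets of rows *)

Section Strict.
Variable m : nat.
Local Notation n := m.+1.
Implicit Types (g : {ffun 'I_n -> 'I_n}) (f : {ffun 'I_n -> bool}).

Definition parts g : seq nat := filter (leq 1) (mkseq (lv g) n).
Definition nonparts g : seq nat := filter (fun c => c \notin parts g) (iota 0 n).

Lemma mkseq_sorted (F : nat -> nat) k : (forall i, F i.+1 <= F i)%N -> sorted geq (mkseq F k).
Proof.
move=> FP; rewrite /mkseq sorted_map.
apply: (sub_sorted (e := fun i j => j == i.+1)) => [i j /eqP ->|]; first exact: FP.
by case: k => //= k; elim: k 0%N => //= k IHk i; rewrite eqxx IHk.
Qed.

Lemma strict_sorted g : strict g -> sorted geq (mkseq (lv g) n).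
Proof.
by move=> /strictP sg; apply: mkseq_sorted => i; apply: leq_trans (sg i) (leq_pred _).
Qed.

Lemma nth_parts g i : strict g -> nth 0%N (parts g) i = lv g i.
Proof.
move=> sg; rewrite nth_filter_pos ?strict_sorted //.
case: (ltnP i n) => ni; first by rewrite nth_mkseq.
by rewrite nth_default ?size_mkseq // lv_out.
Qed.

Lemma lv_pos g i : strict g -> (0 < lv g i)%N = (i < size (parts g))%N.
Proof.
move=> sg; rewrite -nth_parts //; case: (ltnP i (size _)) => ip; last by rewrite nth_default.
have : nth 0%N (parts g) i \in parts g by apply: mem_nth.
by rewrite mem_filter => /andP[].
Qed.

Lemma mem_parts g c : (c \in parts g) = (0 < c)%N && [exists i : 'I_n, g i == c :> nat].
Proof.
rewrite mem_filter; congr (_ && _); apply/mapP/existsP => [[i]|[i /eqP gi]].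
  rewrite mem_iota => /= ni ->; exists (Ordinal ni); by rewrite (lv_ord g (Ordinal ni)).
by exists (val i); rewrite ?mem_iota ?lv_ord //= ltn_ord.
Qed.

Lemma sum_parts g : (\sum_(c <- parts g) c = \sum_(i < n) lv g i)%N.
Proof.
rewrite big_filter big_mkcond big_map -(big_mkord xpredT) /index_iota subn0.
by apply: eq_bigr => i _; case: (lv g i).
Qed.

Lemma parts_sorted g : strict g -> sorted gtn (parts g).
Proof.
move=> sg; apply/(sortedP 0%N) => i ip; rewrite !nth_parts //.
have := strictP _ sg i; have := lv_pos i sg; rewrite (ltn_trans (ltnSn i) ip) /=; lia.
Qed.

(** Row 0 is excluded from the sets in [sum_strict], so the zero padding of a layer causes no
    ambiguity. *)
Definition set_layer f : {ffun 'I_n -> 'I_n} :=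
  mkl n m (nth 0%N (rev (filter (fun c => f (inord c)) (iota 0 n)))).
Definition layer_set g : {ffun 'I_n -> bool} := [ffun c : 'I_n => val c \in parts g].

Lemma lv_set_layer f i :
  lv (set_layer f) i = nth 0%N (rev (filter (fun c => f (inord c)) (iota 0 n))) i.
Proof.
have szn : (size (filter (fun c => f (inord c)) (iota 0 n)) <= n)%N.
  by rewrite size_filter -[X in (_ <= X)%N](size_iota 0 n) count_size.
rewrite lv_mkl // => [|ni]; last by rewrite nth_default // size_rev (leq_trans szn).
case: (ltnP i (size (rev (filter (fun c => f (inord c)) (iota 0 n))))) => ilt; last by rewrite nth_default.
have := mem_nth 0%N ilt; rewrite mem_rev mem_filter mem_iota => /andP[_ /=].
by rewrite add0n ltnS.
Qed.

Lemma set_sorted f : sorted gtn (rev (filter (fun c => f (inord c)) (iota 0 n))).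
Proof. by rewrite rev_sorted sorted_filter ?iota_ltn_sorted //; apply: ltn_trans. Qed.

Lemma set_layer_strict f : strict (set_layer f).
Proof.
apply/strictP => i; rewrite !lv_set_layer; set s := rev _.
case: (ltnP i.+1 (size s)) => ilt; last by rewrite [X in (X <= _)%N]nth_default.
by have := sortedP 0%N (set_sorted f) i ilt; rewrite -/s /=; lia.
Qed.

Lemma parts_set_layer f : f ord0 = false ->
  parts (set_layer f) = rev (filter (fun c => f (inord c)) (iota 0 n)).
Proof.
move=> f0; apply: (@irr_sorted_eq _ gtn); first by move=> a b c /=; lia.
- by move=> a /=; rewrite ltnn.
- exact/parts_sorted/set_layer_strict.
- exact: set_sorted.
move=> c; rewrite mem_parts mem_rev mem_filter mem_iota /= add0n.
apply/andP/andP => [[c0 /existsP[i /eqP ci]]|[fc cn]].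
  rewrite -lv_ord lv_set_layer in ci.
  have : c \in rev (filter (fun c => f (inord c)) (iota 0 n)).
    rewrite -ci; apply: mem_nth; rewrite ltnNge; apply: contraTN c0 => si.
    by rewrite -ci nth_default.
  by rewrite mem_rev mem_filter mem_iota => /andP[].
split.
  by case: c fc cn => // fc _; rewrite (_ : inord 0 = ord0) ?f0 // in fc; apply: val_inj; rewrite /= inordK.
have cs : c \in rev (filter (fun c => f (inord c)) (iota 0 n)).
  by rewrite mem_rev mem_filter mem_iota fc.
have /(nthP 0%N) [i ilt ci] := cs; rewrite -ci in cn *.
have iN : (i < n)%N.
  apply: leq_trans ilt _; rewrite size_rev size_filter.
  by rewrite -[X in (_ <= X)%N](size_iota 0 n) count_size.
by apply/existsP; exists (Ordinal iN); rewrite -lv_ord lv_set_layer.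
Qed.

Lemma sum_strict (V : nmodType) (F : {ffun 'I_n -> 'I_n} -> V) :
  \sum_(g | strict g) F g = \sum_(f : {ffun 'I_n -> bool} | ~~ f ord0) F (set_layer f).
Proof.
rewrite (reindex_onto set_layer layer_set) => [|g sg].
  apply: eq_bigl => f; rewrite set_layer_strict /=; apply/eqP/idP => [<-|/negPf f0].
    by rewrite ffunE mem_parts.
  apply/ffunP => c; rewrite ffunE parts_set_layer // mem_rev mem_filter mem_iota.
  by rewrite /= inord_val add0n ltn_ord andbT.
have g0 : layer_set g ord0 = false by rewrite ffunE mem_parts.
apply: lv_inj => i; rewrite -!nth_parts ?set_layer_strict // parts_set_layer //.
congr (nth _ _ i); apply: (@irr_sorted_eq _ gtn); first by move=> a b c /=; lia.
- by move=> a /=; rewrite ltnn.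
- exact: set_sorted.
- exact: parts_sorted.
move=> c; rewrite mem_rev mem_filter mem_iota /= add0n ltnS.
case: (leqP c m) => cm; first by rewrite ffunE /= inordK // andbT.
rewrite andbF mem_parts; apply/esym/andP => -[_ /existsP[i' /eqP E]].
by have := ltn_ord (g i'); rewrite E; lia.
Qed.

Variable R : comNzRingType.

(** Expand over the set of rows whose second summand is taken, then list these rows first in
    decreasing order. By [seq_det_sort] the sorting sign is (-1) to the sum of the parts, and it
    cancels the signs (-1)^c of the chosen rows. *)
Lemma det_two_rows (N Z : nat -> 'I_n -> R) :
  \det (\matrix_(c < n, j < n) (Z c j + (if val c is b.+1 then (-1) ^+ c * N b j else 0))) =
  \sum_(g : {ffun 'I_n -> 'I_n} | strict g)
    \det (\matrix_(i, j) if lv g i is b.+1 then N b j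
                         else Z (nth 0%N (nonparts g) (i - size (parts g))) j).
Proof.
pose row (e : bool) (c : nat) (j : 'I_n) : R :=
  if e then (if c is b.+1 then (-1) ^+ c * N b j else 0) else Z c j.
transitivity (\sum_(f : {ffun 'I_n -> bool}) \det (\matrix_(c, j) row (f c) c j)).
  transitivity (\det (\matrix_(c < n, j < n) \sum_(e : bool) 1 * row e c j)).
    congr (\det _); apply/matrixP => c j; rewrite !mxE big_bool /row /= !mul1r addrC.
    by case: (nat_of_ord c).
  by rewrite det_expand; apply: eq_bigr => f _; rewrite big1 ?mul1r.
(* Row 0 has no second summand, so a set containing 0 yields a zero row. *)
rewrite sum_strict (bigID (fun f : {ffun 'I_n -> bool} => f ord0)) /= big1 ?add0r; last first.
  move=> f f0; rewrite (expand_det_row _ ord0) big1 // => j _.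
  by rewrite mxE f0 /row mul0r.
apply: eq_bigr => f /negPf f0.
pose g := set_layer f; have sg : strict g := set_layer_strict f.
have gE := parts_set_layer f0; rewrite -/g in gE.
pose P c := f (inord c).
pose r c := row (P c) c.
transitivity (seq_det (map r (iota 0 n))).
  congr (\det _); apply/matrixP => i j; rewrite !mxE (nth_map 0%N) ?size_iota ?ltn_ord //.
  by rewrite nth_iota ?ltn_ord // add0n /r /P inord_val.
rewrite (@seq_det_sort _ _ P _ n) // subnn cats0.
have NE : nonparts g = filter (predC P) (iota 0 n).
  apply: eq_in_filter => c cn /=.
  by rewrite gE mem_rev mem_filter cn andbT.
rewrite -NE -gE /seq_det.
pose a (i : 'I_n) : R := (-1) ^+ lv g i.
pose M (i j : 'I_n) : R := if lv g i is b.+1 then N b j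
                         else Z (nth 0%N (nonparts g) (i - size (parts g))) j.
transitivity ((-1) ^+ (\sum_(c <- iota 0 n | P c) c)%N * \det (\matrix_(i, j) (a i * M i j))).
  congr (_ * _); congr (\det _); apply/matrixP => i j; rewrite !mxE map_cat nth_cat size_map /M /a.
  case: ltnP => ip.
    rewrite (nth_map 0%N) // nth_parts // /r /row /P.
    have : lv g i \in parts g by rewrite -nth_parts // mem_nth.
    rewrite gE mem_rev mem_filter => /andP[-> _].
    by have := lv_pos i sg; rewrite ip; case: (lv g i).
  have := lv_pos i sg; rewrite [(i < _)%N]ltnNge ip /=; case: (lv g i) => // _; rewrite mul1r.
  have isz : (i - size (parts g) < size (nonparts g))%N.
    rewrite ltn_subLR // NE gE size_rev -/P !size_filter count_predC size_iota; exact: ltn_ord.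
  rewrite (nth_map 0%N) // /r /row.
  by have := mem_nth 0%N isz; rewrite {2}NE mem_filter /= => /andP[/negPf -> _].
rewrite det_row_scale mulrA -/M.
have -> : \prod_i a i = (-1) ^+ (\sum_(c <- iota 0 n | P c) c)%N.
  rewrite /a prodrXr; congr (_ ^+ _).
  by rewrite -sum_parts gE (perm_big (filter P (iota 0 n))) ?perm_rev // big_filter.
by rewrite -expr2 sqrr_sign mul1r.
Qed.
End Strict.

(** * Partitions attached to chains *)

Lemma count_ltn (p : pred nat) N k : (k <= N)%N ->
  (forall j, (j < N)%N -> p j = (j < k)%N) -> count p (iota 0 N) = k.
Proof.
move=> kN pE; rewrite (@eq_in_count _ _ (fun j => j < k)%N); last first.
  by move=> j; rewrite mem_iota add0n => /pE.
rewrite -(subnKC kN) iotaD count_cat add0n.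
rewrite (@eq_in_count _ _ predT) ?count_predT ?size_iota; last first.
  by move=> j; rewrite mem_iota add0n => /andP[_ ->].
rewrite (@eq_in_count _ _ pred0) ?count_pred0 ?addn0 // => j.
by rewrite mem_iota => /andP[kj _] /=; rewrite ltnNge kj.
Qed.

Lemma nth_filter_iota (p : pred nat) N k : (k < size (filter p (iota 0 N)))%N ->
  let c := nth 0%N (filter p (iota 0 N)) k in
  [/\ p c, (c < N)%N & count p (iota 0 c) = k].
Proof.
move=> ks c; have cs : c \in filter p (iota 0 N) by apply: mem_nth.
have := cs; rewrite mem_filter mem_iota add0n => /and3P[pc _ cN]; split=> //.
have E : filter p (iota 0 N) =
    filter p (iota 0 c) ++ c :: filter p (iota c.+1 (N - c.+1)).
  have {1}-> : (N = c + (N - c.+1).+1)%N by lia.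
  by rewrite iotaD filter_cat add0n /= pc.
have <- := index_uniq 0%N ks (filter_uniq p (iota_uniq 0 N)).
rewrite -/c {1}E index_cat mem_filter mem_iota /= add0n ltnn andbF eqxx addn0.
by rewrite size_filter.
Qed.

Lemma leq_nth_sumn s i : (nth 0%N s i <= sumn s)%N.
Proof.
elim: s i => [|a s IHs] [|i] //=; first exact: leq_addr.
by rewrite (leq_trans (IHs i)) ?leq_addl.
Qed.

Section ChainPartition.
Variable m : nat.
Local Notation n := m.+1.
Local Notation layer := {ffun 'I_n -> 'I_n}.
Implicit Types (g : layer) (c : seq layer).

Definition arms g c : seq nat := mkseq (height c) (size (parts g)).

Lemma strict_gap g i j : strict g -> (i <= j)%N -> (0 < lv g j)%N ->
  (lv g j + (j - i) <= lv g i)%N.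
Proof.
move=> /strictP sg ij; rewrite -(subnKC ij) addKn; elim: (j - i)%N => [|d IHd].
  by rewrite !addn0.
by rewrite addnS; have := sg (i + d)%N; lia.
Qed.

Lemma parts_uniq g : strict g -> uniq (parts g).
Proof.
by move=> /parts_sorted; apply: (@sorted_uniq _ gtn (rev_trans ltn_trans)) => i; exact: ltnn.
Qed.

Lemma size_parts g : strict g -> (size (parts g) <= m)%N.
Proof.
move=> sg; case E : (size (parts g)) => [//|k].
have g1 : (0 < lv g k)%N by rewrite lv_pos // E.
have := strict_gap sg (leq0n k) g1; have := lv_lt g 0; lia.
Qed.

(** Interlacing gives h_i >= g_(i+1) > h_(i+1): part i is still positive whenever part i + 1 was
    positive one step earlier, and the chain is long enough for both to die out. *)
Lemma height_strict g c i : strict g -> path (@below n n) g c ->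
  (forall i, lv g i <= size c)%N -> (0 < lv g i.+1)%N -> (height c i.+1 < height c i)%N.
Proof.
elim: c g => [|h c IHc] g sg /=; first by move=> _ /(_ i.+1) /=; lia.
move=> /andP[gh hc] gc g1; have /belowP ghP := gh; have sh := below_strict sg gh.
have g0 : (0 < lv g i)%N by have := strictP _ sg i; lia.
have h0 : (0 < lv h i)%N by have := ghP i; rewrite g0; lia.
rewrite h0 add1n ltnS -!/(height c _); case: (posnP (lv h i.+1)) => h1.
  by rewrite (height0 hc h1).
rewrite add1n; apply: (IHc h) => // k.
by have := ghP k; have := gc k; case: ifP; lia.
Qed.

Lemma count_parts g (N : nat) : strict g ->
  count (mem (parts g)) (iota 0 N) = count (fun j => j < N)%N (parts g).
Proof.
move=> sg; rewrite -!size_filter; apply/perm_size/uniq_perm => [||j].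
- exact/filter_uniq/iota_uniq.
- exact/filter_uniq/parts_uniq.
by rewrite [LHS]mem_filter [RHS]mem_filter mem_iota /= add0n andbC.
Qed.

Lemma size_nonparts g : strict g -> size (nonparts g) = (n - size (parts g))%N.
Proof.
move=> sg; have := count_predC (mem (parts g)) (iota 0 n).
rewrite size_iota count_parts // (@eq_in_count _ _ predT (parts g)) ?count_predT => [E|j].
  by rewrite size_filter (eq_count (a2 := predC (mem (parts g)))) // -[LHS](addKn (size (parts g))) E.
by rewrite mem_parts => /andP[_ /existsP[a /eqP <-]]; rewrite ltn_ord.
Qed.

(** Let q be the number of parts exceeding k and l the number of parts. The k integers below k
    consist of i - l nonparts and l - q parts, hence i = k + q. *)
Lemma rank_nonparts g i : strict g -> (size (parts g) <= i < n)%N ->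
  let k := nth 0%N (nonparts g) (i - size (parts g)) in
  exists q, [/\ i = (k + q)%N, forall j, (k < lv g j)%N = (j < q)%N & k \notin parts g].
Proof.
move=> sg /andP[li ni] k; set l := size (parts g) in li k *.
have ks : (i - l < size (nonparts g))%N by rewrite size_nonparts // -/l; lia.
have [pk kn Ek] := nth_filter_iota ks; rewrite -/(nonparts g) -/k in pk kn Ek.
pose q := count (fun j => k < nth 0%N (parts g) j)%N (iota 0 l).
have qE : q = count (fun j => k < j)%N (parts g).
  by rewrite /q -[in RHS](mkseq_nth 0%N (parts g)) count_map.
exists q; split=> // [|j].
  have A : (count (fun j => j < k)%N (parts g) + (i - l) = k)%N.
    by rewrite -count_parts // -[X in (_ + X)%N]Ek count_predC size_iota.
  have B : (q + count (fun j => j < k)%N (parts g) = l)%N.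
    rewrite qE -[RHS](count_predC (fun j => k < j)%N); congr (_ + _)%N.
    apply: eq_in_count => j jp /=; rewrite -leqNgt [RHS]leq_eqVlt.
    by case: eqP => // jk; case/negP: pk; rewrite -jk.
  by move: A B li; clear; lia.
rewrite -nth_parts //; case: (ltnP j l) => jl.
  rewrite count_downset // => a; rewrite !nth_parts // => ka.
  by apply: leq_trans ka (leq_trans (strictP _ sg a) (leq_pred _)).
rewrite nth_default // ltn0; apply/esym/negbTE; rewrite -leqNgt (leq_trans _ jl) //.
by rewrite -[X in (_ <= X)%N](size_iota 0) count_size.
Qed.

(** Row i < l of the partition has length i + a_i + 1, which gives the exponent n + a_i. A later row
    i = k + q meets exactly the legs of the q parts exceeding k, which gives m - i + q = m - k. *)
Lemma part_of_frobP g c : strict g -> path (@below n n) g c -> (m <= size c)%N ->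
  let la := part_of_frob (arms g c) (parts g) in
  [/\ sorted geq la, (size la <= n)%N &
    forall i : 'I_n, (nth 0%N la i + (n.-1 - i) =
      if 0 < lv g i then n + height c i
      else m - nth 0%N (nonparts g) (i - size (parts g)))%N].
Proof.
move=> sg gc mc la.
set l := size (parts g).
have lm : (l <= m)%N := size_parts sg.
have szarms : size (arms g c) = l by rewrite size_mkseq.
have gmax i : (lv g i <= m)%N by have := lv_lt g i; lia.
set N := (l + sumn (arms g c) + sumn (parts g)).+1.
pose row i := count (frob_cell (arms g c) (parts g) i) (iota 0 N).
have laE : la = filter (leq 1) (mkseq row N) by rewrite /la /part_of_frob szarms.
have rowlt i : (i < l)%N -> row i = (i + height c i).+1.
  move=> il; have ai : nth 0%N (arms g c) i = height c i by rewrite nth_mkseq.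
  have aN := leq_nth_sumn (arms g c) i; rewrite ai in aN.
  apply: count_ltn => [|j jN]; first by rewrite /N; lia.
  rewrite /frob_cell szarms il ai; case: (leqP i j) => ij //=; rewrite nth_parts //.
  rewrite (ltn_trans ij il) /=; apply/idP/idP => _; first by lia.
  have := strict_gap sg (ltnW ij); rewrite lv_pos // => /(_ il); lia.
have rowge i : (l <= i)%N ->
    row i = count (fun j => (j < l) && (i <= j + lv g j))%N (iota 0 N).
  move=> li; apply: eq_in_count => j _; rewrite /frob_cell szarms nth_parts //.
  by case: (leqP i j) => ij //; rewrite !ltnNge li (leq_trans li ij).
have rowdec i : (row i.+1 <= row i)%N.
  case: (ltnP i.+1 l) => il.
    rewrite !rowlt ?(ltnW il) //; have := @height_strict g c i sg gc.
    rewrite lv_pos // il => /(_ _ isT) H; suff : (height c i.+1 < height c i)%N by lia.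
    by apply: H => j; apply: leq_trans (gmax j) mc.
  rewrite (rowge i.+1) //; case: (ltnP i l) => li.
    rewrite rowlt // (leq_trans (sub_count (a2 := fun j => j < l)%N _ _)) //.
      by move=> j /andP[].
    by rewrite (@count_ltn _ _ l) // /N; lia.
  by rewrite (rowge i) //; apply: sub_count => j /andP[-> ] /=; apply: ltnW.
have srt : sorted geq (mkseq row N) by apply: mkseq_sorted.
have rowN i : (N <= i)%N -> row i = 0%N.
  move=> Ni; rewrite rowge; last by rewrite /N in Ni; lia.
  apply: count_ltn => // j _; rewrite ltn0; apply/negbTE.
  rewrite negb_and -!leqNgt orbC -ltnNge -nth_parts //.
  by have := leq_nth_sumn (parts g) j; rewrite /N in Ni; lia.
have laN i : nth 0%N la i = row i.
  rewrite laE nth_filter_pos //; case: (ltnP i N) => iN; first by rewrite nth_mkseq.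
  by rewrite nth_default ?size_mkseq // rowN.
have row_n : row n = 0%N.
  rewrite rowge; last by lia.
  apply: count_ltn => // j _; rewrite ltn0; apply/negbTE/negP => /andP[jl].
  have := strict_gap sg (leq0n j); rewrite lv_pos // => /(_ jl); have := gmax 0%N; lia.
split.
- by rewrite laE; apply: sorted_filter srt => a b d /= ; lia.
- rewrite leqNgt; apply/negP => szn; have := mem_nth 0%N szn.
  by rewrite laN row_n laE mem_filter.
move=> i; rewrite laN lv_pos // -/l; case: ltnP => li.
  by rewrite rowlt //=; have := ltn_ord i; lia.
have [|q [iE kq kp]] := @rank_nonparts g i sg; first by rewrite li ltn_ord.
set k := nth 0%N _ _ in iE kq kp *.
(* As lv g j + j is weakly decreasing over the parts, the legs reaching row i are those with index j
   < q. *)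
suff -> : row i = q by have := ltn_ord i; lia.
have ql : (q <= l)%N.
  by case: q kq {iE} => // q /(_ q); rewrite ltnSn => /(leq_ltn_trans (leq0n _)); rewrite lv_pos.
rewrite rowge //; apply: count_ltn => [|j jN]; first by rewrite /N; lia.
case: (ltnP j q) => jq.
  have jl := leq_trans jq ql; rewrite jl /=.
  have kq1 : (k < lv g q.-1)%N by rewrite kq; lia.
  have := @strict_gap g j q.-1 sg; rewrite (leq_ltn_trans (leq0n _) kq1); lia.
case: (ltnP j l) => // jl /=; apply/negbTE; rewrite -ltnNge.
have jk : (lv g j < k)%N.
  have := kq j; rewrite [(j < q)%N]ltnNge jq /= => /negbT; rewrite -leqNgt leq_eqVlt.
  by case: eqP => // jk; move: kp; rewrite -jk -nth_parts // mem_nth.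
have := strict_gap sg jq; rewrite lv_pos // => /(_ jl).
have : (lv g q <= k)%N by rewrite leqNgt kq ltnn.
have : lv g q != k.
  apply: contraNneq kp => <-; rewrite -nth_parts // mem_nth //.
  exact: leq_ltn_trans jq jl.
by rewrite iE; lia.
Qed.

Lemma sum_nonparts g : strict g ->
  (\sum_(k <- nonparts g) k = 'C(n, 2) - \sum_(k <- parts g) k)%N.
Proof.
move=> sg; suff : (\sum_(k <- parts g) k + \sum_(k <- nonparts g) k = 'C(n, 2))%N by lia.
have us := iota_uniq 0 n; have ms j : (j \in iota 0 n) = (j < n)%N by rewrite mem_iota.
rewrite -bin2_sum /index_iota subn0 /nonparts; move: (iota 0 n) us ms => s us ms.
rewrite [RHS](bigID (mem (parts g))) /= [X in (_ + X)%N = _]big_filter; congr (_ + _)%N.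
rewrite -[RHS]big_filter; apply: perm_big; apply: uniq_perm => [||j].
- exact: parts_uniq.
- exact: filter_uniq.
rewrite [RHS]mem_filter ms /=; case: (boolP (j \in parts g)) => //=.
by rewrite mem_parts => /andP[_ /existsP[a /eqP <-]]; rewrite ltn_ord.
Qed.

Lemma prod_parts (R : comNzRingType) g (F : nat -> R) : strict g ->
  \prod_(i < n | (0 < lv g i)%N) F i = \prod_(i < size (parts g)) F i.
Proof.
move=> sg; rewrite (big_ord_widen n F (leqW (size_parts sg))).
by apply: eq_bigl => i; rewrite lv_pos.
Qed.

(** Take y = u x^n and t = u x in [chain_expand]: a row frozen at height h is u^(h+1) x^(n+h), and a
    row never chosen is v^k x^(m-k) for a nonpart k. The scalars taken out of the rows, with the
    powers of w, form [omega]; the powers of x form the alternant of the partition. *)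
Theorem det_hookrow_chains (R : comNzRingType) (u v : R) (x : 'I_n -> R) :
  \det (\matrix_(c < n, j < n) hookrow u v (1 - u - v) n (x j) c) =
  \sum_(g : layer | strict g) \sum_(c : m.-tuple layer | path (@below n n) g c)
    omega u v n (arms g c) (parts g) *
    \det (\matrix_(i < n, j < n)
      x j ^+ (nth 0%N (part_of_frob (arms g c) (parts g)) i + (n.-1 - i))).
Proof.
set w := 1 - u - v.
pose Z (k : nat) (j : 'I_n) := v ^+ k * x j ^+ (m - k).
pose N (b : nat) (j : 'I_n) := u * x j ^+ n * (w + u * x j) ^+ b.
transitivity (\det (\matrix_(c < n, j < n)
   (Z c j + (if val c is b.+1 then (-1) ^+ c * N b j else 0)))).
  congr (\det _); apply/matrixP => c j; rewrite !mxE /hookrow; congr (_ + _).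
  by case: c => -[|b] cn //=; rewrite /N -mulrA.
rewrite det_two_rows; apply: eq_bigr => g sg.
pose rho (i j : 'I_n) := Z (nth 0%N (nonparts g) (i - size (parts g))) j.
transitivity (\det (layer_mx w (fun j => u * x j) g (fun j => u * x j ^+ n) rho)).
  by congr (\det _); apply/matrixP => i j; rewrite !mxE.
rewrite (@chain_expand _ _ _ _ _ m) //; last by move=> i; have := lv_lt g i; lia.
apply: eq_bigr => c gc.
have [_ _ expE] := part_of_frobP sg gc (eq_leq (esym (size_tuple c))).
pose a (i : 'I_n) := if (0 < lv g i)%N then u ^+ (height c i).+1
                     else v ^+ nth 0%N (nonparts g) (i - size (parts g)).
transitivity ((\prod_(i < n | (0 < lv g i)%N) w ^+ ((lv g i).-1 - height c i)) *
  \det (\matrix_(i, j) (a i * x j ^+ (nth 0%N (part_of_frob (arms g c) (parts g)) i + (n.-1 - i))))).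
  congr (_ * \det _); apply/matrixP => i j; rewrite !mxE expE /a /rho /Z.
  by case: ifP => // _; rewrite exprMn exprD [u ^+ _.+1]exprS; ring.
rewrite det_row_scale mulrA; congr (_ * _).
rewrite [X in _ * X = _](bigID (fun i : 'I_n => 0 < lv g i)%N) /= /omega size_mkseq.
have -> : \prod_(i < n | (0 < lv g i)%N) a i = \prod_(i < n | (0 < lv g i)%N) u ^+ (height c i).+1.
  by apply: eq_bigr => i gi; rewrite /a gi.
rewrite (prod_parts (fun i => u ^+ (height c i).+1)) //.
rewrite (prod_parts (fun i => w ^+ ((lv g i).-1 - height c i))) // !prodrXr.
rewrite mulrCA mulrA; congr (_ ^+ _ * _ ^+ _ * _).
- by apply: eq_bigr => i _; rewrite nth_mkseq.
- by apply: eq_bigr => i _; rewrite nth_mkseq // nth_parts // subn1.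
transitivity (v ^+ (\sum_(k <- nonparts g) k)%N); last first.
  by rewrite sum_nonparts // (big_nth 0%N) big_mkord.
rewrite -prodrXr (big_nth 0%N) big_mkord size_nonparts //.
have li : (size (parts g) <= n)%N := leqW (size_parts sg).
pose F k := if (size (parts g) <= k)%N then v ^+ nth 0%N (nonparts g) (k - size (parts g)) else 1.
symmetry; transitivity (\prod_(i < n) F i).
  rewrite /F -[RHS](big_mkord xpredT F) (big_cat_nat (leq0n _) li) //= /F.
  rewrite [X in _ = X * _]big_nat [X in _ = X * _]big1 ?mul1r => [|i il]; last by case/andP: il => _ il; rewrite leqNgt il.
  have := big_addn 0 n (size (parts g)) xpredT F; rewrite add0n /F => ->.
  rewrite big_mkord.
  by apply: eq_bigr => i _; rewrite leq_addl addnK.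
rewrite [RHS]big_mkcond /=; apply: eq_bigr => i _.
by rewrite /F /a lv_pos // -leqNgt; case: leqP.
Qed.
End ChainPartition.

(** * Totally symmetric plane partitions *)

Section Triangle.
Variable m : nat.
Implicit Types (G : nat -> nat -> nat).

(** [G k i] stands for part i of the k-th layer of a chain; the conditions are those of [strict] and
    [below], for functions on all naturals. *)
Definition triangle G : Prop :=
  (forall i, G 0 i <= m /\ G 0 i.+1 <= (G 0 i).-1)%N /\
  (forall k i, if 0 < G k i then G k i.+1 <= G k.+1 i < G k i else G k.+1 i == 0%N)%N.

(** After sorting, hi < T(lo, mid) is equivalent to hi < mid + (T(lo, mid) - mid) even with
    truncated subtraction, because hi >= mid. Sorting makes the set symmetric by construction. *)
Definition cube3 G (x y z : nat) : bool :=
  let lo := minn x (minn y z) in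
  let hi := maxn x (maxn y z) in
  let mid := (x + y + z - lo - hi)%N in
  (hi < mid + G (mid - lo) lo)%N.

Lemma cube3_sorted G p q r : (p <= q)%N -> (q <= r)%N ->
  cube3 G p q r = (r < q + G (q - p) p)%N.
Proof.
move=> pq qr; rewrite /cube3.
have -> : minn p (minn q r) = p by lia.
have -> : maxn p (maxn q r) = r by lia.
by have -> : (p + q + r - p - r)%N = q by lia.
Qed.

Lemma cube3C12 G x y z : cube3 G x y z = cube3 G y x z.
Proof. by rewrite /cube3 minnCA maxnCA [(x + y)%N]addnC. Qed.

Lemma cube3C23 G x y z : cube3 G x y z = cube3 G x z y.
Proof. by rewrite /cube3 [minn y z]minnC [maxn y z]maxnC addnAC. Qed.

Lemma sorted_ind3 (P : nat -> nat -> nat -> Prop) :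
  (forall x y z, P x y z -> P y x z) -> (forall x y z, P x y z -> P x z y) ->
  (forall p q r, (p <= q)%N -> (q <= r)%N -> P p q r) -> forall x y z, P x y z.
Proof.
move=> P12 P23 Ps x y z.
have Pxy x' y' : (x' <= y')%N -> P x' y' z.
  move=> xy; case: (leqP y' z) => yz; first exact: Ps.
  apply: P23; case: (leqP x' z) => xz; first by apply: Ps => //; apply: ltnW.
  by apply: P12; apply: Ps => //; apply: ltnW.
by case: (leqP x y) => xy; [exact: Pxy | apply/P12/Pxy/ltnW].
Qed.

Lemma triangle_dec G : triangle G -> forall k i, (G k i.+1 <= (G k i).-1)%N.
Proof.
move=> [G0 Gb]; elim=> [|k IHk] i; first by case: (G0 i).
by have := IHk i; move: (Gb k i) (Gb k i.+1); case: ifP => ?; case: ifP => ?; lia.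
Qed.

Lemma triangle_bound G k i : triangle G -> (0 < G k i)%N -> (G k i + (i + k) <= m)%N.
Proof.
move=> tG; have dG := triangle_dec tG; elim: k => [|k IHk].
  rewrite addn0; elim: i => [|i IHi] Gi; first by rewrite addn0; case: (tG.1 0%N).
  by have := dG 0%N i; move: IHi; lia.
by move=> Gi; move: (tG.2 k i) IHk; case: ifP; lia.
Qed.

(** Here q + G (q - p) p plays the role of T(p, q). Lowering p at fixed q' uses the lower bound of
    the interlacing condition; lowering q at fixed p uses the strict upper bound. *)
Lemma triangle_down G p q p' q' : triangle G ->
    (p <= p')%N -> (p' <= q')%N -> (p <= q)%N -> (q <= q')%N ->
    (0 < G (q' - p') p')%N ->
  (q' + G (q' - p') p' <= q + G (q - p) p)%N.
Proof.
move=> tG pp' pq' pq qq' G0.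
have left_step d : (p + d <= q')%N -> (G (q' - (p + d)) (p + d) <= G (q' - p) p)%N.
  elim: d => [|d IHd] pd; first by rewrite addn0.
  apply: leq_trans (IHd _); last by lia.
  have := tG.2 (q' - (p + d.+1))%N (p + d)%N; have := triangle_dec tG (q' - (p + d.+1))%N (p + d)%N.
  have -> : (q' - (p + d) = (q' - (p + d.+1)).+1)%N by lia.
  by rewrite addnS; case: ifP; lia.
have down_step d : (0 < G (q - p + d) p)%N ->
    (q + d + G (q - p + d) p <= q + G (q - p) p)%N.
  elim: d => [|d IHd]; first by rewrite !addn0.
  by rewrite addnS => Gd; move: IHd (tG.2 (q - p + d)%N p); case: ifP; lia.
have := left_step (p' - p)%N; rewrite subnKC // => /(_ pq') L.
have := down_step (q' - q)%N; have -> : (q - p + (q' - q) = q' - p)%N by lia.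
by move=> /(_ (leq_trans G0 L)); lia.
Qed.

Lemma cube3_ltm G x y z : triangle G -> cube3 G x y z -> [/\ x < m, y < m & z < m]%N.
Proof.
move=> tG; rewrite /cube3; set lo := minn _ _; set hi := maxn _ _; set mid := (_ - _)%N => H.
have lm : (lo <= mid)%N by rewrite /mid /lo /hi; lia.
have mh : (mid <= hi)%N by rewrite /mid /lo /hi; lia.
have := @triangle_bound G (mid - lo) lo tG; rewrite subnKC // => B.
have : (hi < m)%N by have := B _; lia.
by rewrite /hi; clear; split; lia.
Qed.

(** Lowering one coordinate weakly lowers each of the three sorted coordinates, so [triangle_down]
    applies; membership makes the relevant entry of [G] positive. *)
Lemma cube3_down G x y z : triangle G -> cube3 G x y z.+1 -> cube3 G x y z.
Proof.
move=> tG; rewrite /cube3.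
set lo' := minn x (minn y z.+1); set hi' := maxn x (maxn y z.+1).
set mid' := (x + y + z.+1 - lo' - hi')%N.
set lo := minn x (minn y z); set hi := maxn x (maxn y z).
set mid := (x + y + z - lo - hi)%N => H.
have h1 : (lo <= lo')%N by rewrite /lo /lo'; lia.
have h2 : (lo' <= mid')%N by rewrite /mid' /lo' /hi'; lia.
have h3 : (lo <= mid)%N by rewrite /mid /lo /hi; lia.
have h4 : (mid <= mid')%N by rewrite /mid /mid' /lo /lo' /hi /hi'; lia.
have h5 : (mid' <= hi')%N by rewrite /mid' /lo' /hi'; lia.
have h6 : (hi <= hi')%N by rewrite /hi /hi'; lia.
by have := triangle_down tG h1 h2 h3 h4; lia.
Qed.

End Triangle.

Section TSPP.
Variable m : nat.
Local Notation n := m.+1.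
Local Notation layer := {ffun 'I_n -> 'I_n}.
Local Notation tspp := {ffun 'I_m * 'I_m -> 'I_m.+1}.
Implicit Types (T : tspp) (g : layer) (G : nat -> nat -> nat).

Definition cube T (x y z : nat) : bool := (z < tv T x y)%N.

Lemma tv_le T x y : (tv T x y <= m)%N.
Proof.
rewrite /tv; case: insubP => // a _ _; case: insubP => // b _ _.
by rewrite -ltnS ltn_ord.
Qed.

Lemma tv_out T x y : (m <= x)%N || (m <= y)%N -> tv T x y = 0%N.
Proof.
by rewrite /tv => /orP[] h; [rewrite insubN | rewrite [insub y]insubN; first by case: insub]; rewrite -?leqNgt.
Qed.

Lemma cube_lt T x y z : cube T x y z -> [/\ x < m, y < m & z < m]%N.
Proof.
rewrite /cube => H; split; last exact: leq_trans H (tv_le T x y).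
  by rewrite ltnNge; apply: contraTN H => h; rewrite tv_out ?h.
by rewrite ltnNge; apply: contraTN H => h; rewrite tv_out ?h ?orbT.
Qed.

(** Two adjacent transpositions generate all permutations of the coordinates. Monotonicity follows
    from symmetry: membership is downward closed in the last coordinate, hence in each. *)
Lemma tsppP T : reflect ((forall x y z, cube T x y z = cube T y x z) /\
                         (forall x y z, cube T x y z = cube T x z y)) (is_tspp T).
Proof.
have memE (i j k : 'I_m) : pp_mem T i j k = cube T i j k by rewrite /cube tv_ord.
apply: (iffP andP) => [[_ /forallP Hs]|[H12 H23]].
  have sym (x y z : 'I_m) : cube T x y z = cube T y x z /\ cube T x y z = cube T x z y.
    have /forallP/(_ y)/forallP/(_ z) := Hs x.
    by rewrite !memE => /and5P[/eqP -> /eqP <- _ _ _].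
  split=> x y z.
    apply/idP/idP => /[dup] /cube_lt[h1 h2 h3].
      by have [<- _] := sym (Ordinal h1) (Ordinal h2) (Ordinal h3).
    by have [<- _] := sym (Ordinal h1) (Ordinal h2) (Ordinal h3).
  apply/idP/idP => /[dup] /cube_lt[h1 h2 h3].
    by have [_ <-] := sym (Ordinal h1) (Ordinal h2) (Ordinal h3).
  by have [_ <-] := sym (Ordinal h1) (Ordinal h2) (Ordinal h3).
have dec x y y' : (y <= y')%N -> (tv T x y' <= tv T x y)%N.
  move=> yy; rewrite leqNgt; apply/negP => lt.
  have : cube T x y' (tv T x y) by [].
  by rewrite H23 => /(leq_ltn_trans yy); rewrite -/(cube T _ _ _) H23 /cube ltnn.
have tvC x y : tv T x y = tv T y x.
  case: (ltngtP (tv T x y) (tv T y x)) => // lt.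
    by have : cube T y x (tv T x y) by []; rewrite H12 /cube ltnn.
  by have : cube T x y (tv T y x) by []; rewrite H12 /cube ltnn.
split.
  apply/'forall_'forall_forallP => i j j'; rewrite -!tv_ord.
  by apply/andP; split; apply/implyP => jj; [|rewrite ![tv T _ i]tvC]; apply: dec.
apply/'forall_'forall_forallP => x y z; rewrite !memE.
rewrite [cube T y x z]H12 [cube T y z x]H23 [cube T y x z]H12 eqxx.
by rewrite [cube T x z y]H23 [cube T z y x]H12 [cube T y z x]H23 [cube T y x z]H12
   [cube T z x y]H12 [cube T x z y]H23 !eqxx.
Qed.

Lemma tv_dec T x y x' y' : is_tspp T -> (x <= x')%N -> (y <= y')%N ->
  (tv T x' y' <= tv T x y)%N.
Proof.
move=> /tsppP[H12 H23] xx yy; rewrite leqNgt; apply/negP => lt.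
have : cube T x' y' (tv T x y) by [].
rewrite H23 => /(leq_ltn_trans yy); rewrite -/(cube T _ _ _) H12 H23 => /(leq_ltn_trans xx).
by rewrite -/(cube T _ _ _) H23 H12 H23 /cube ltnn.
Qed.

Definition gap T (k i : nat) : nat := (tv T i (i + k) - (i + k))%N.

Lemma gap_triangle T : is_tspp T -> triangle m (gap T).
Proof.
move=> tT; split=> [i|k i].
  rewrite /gap !addn0; have := tv_dec tT (leqnSn i) (leqnSn i); have := tv_le T i i; lia.
rewrite /gap.
have h1 := tv_dec tT (leqnn i) (leqnSn (i + k)).
have h2 := tv_dec tT (leqnSn i) (leqnn (i + k).+1).
by rewrite addSn addnS; case: ifP; lia.
Qed.

(** Both sides are symmetric, so sorted coordinates suffice; for these the truncation in [gap] loses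
    nothing. *)
Lemma cube3_gap T x y z : is_tspp T -> cube3 (gap T) x y z = cube T x y z.
Proof.
move=> /tsppP[H12 H23]; move: x y z; apply: sorted_ind3 => [x y z|x y z|p q r pq qr].
- by rewrite cube3C12 H12.
- by rewrite cube3C23 H23.
by rewrite cube3_sorted // /gap /cube subnKC //; lia.
Qed.

Definition of_triangle G : tspp :=
  [ffun p : 'I_m * 'I_m => inord (count (cube3 G p.1 p.2) (iota 0 m))].

Lemma cube_of_triangle G x y z : triangle m G -> cube (of_triangle G) x y z = cube3 G x y z.
Proof.
move=> tG.
suff E : (x < m)%N -> (y < m)%N -> (z < m)%N -> cube (of_triangle G) x y z = cube3 G x y z.
  by apply/idP/idP => [/[dup] /cube_lt[*]|/[dup] /(cube3_ltm tG)[*]]; rewrite ?E // -E.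
move=> h1 h2 h3; rewrite /cube (tv_ord _ (Ordinal h1) (Ordinal h2)) ffunE inordK /=.
  by rewrite count_downset // => j; apply: (cube3_down tG).
by rewrite ltnS -[X in (_ <= X)%N](size_iota 0) count_size.
Qed.

Lemma of_triangle_tspp G : triangle m G -> is_tspp (of_triangle G).
Proof.
move=> tG; apply/tsppP; split=> x y z; rewrite !cube_of_triangle //.
  exact: cube3C12.
exact: cube3C23.
Qed.

(** [cube3_sorted] describes the cubes (i, i + k, z) for z >= i + k only, and truncated subtraction
    of i + k depends on nothing else. *)
Lemma gap_of_triangle G k i : triangle m G -> gap (of_triangle G) k i = G k i.
Proof.
move=> tG; rewrite /gap.
have H z : (i + k <= z)%N -> (z < tv (of_triangle G) i (i + k))%N = (z < i + k + G k i)%N.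
  move=> kz; rewrite -/(cube _ _ _ _) cube_of_triangle // cube3_sorted ?leq_addr //.
  by rewrite addKn.
move: (tv _ _ _) (G k i) H => a b H; case: (ltngtP a (i + k + b)) => [lt|lt|->].
- have := H (i + k + b).-1; case: b lt {H} => [|b]; first by lia.
  by rewrite addnS /= ltnSn => lt /(_ (leq_addr _ _)); lia.
- by have := H (i + k + b)%N (leq_addr _ _); rewrite lt ltnn.
by rewrite addKn.
Qed.

Lemma of_triangle_gap T G : is_tspp T -> (forall k i, G k i = gap T k i) -> of_triangle G = T.
Proof.
move=> tT GE; apply/ffunP => -[x y]; apply: ord_inj; rewrite ffunE inordK /=; last first.
  by rewrite ltnS -[X in (_ <= X)%N](size_iota 0) count_size.
rewrite -tv_ord; apply: count_ltn => [|z _]; first exact: tv_le.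
by rewrite -/(cube T x y z) -cube3_gap // /cube3 !GE.
Qed.

End TSPP.

(** * The bijection between plane partitions and chains *)

Section ChainsOfTSPP.
Variable m : nat.
Local Notation n := m.+1.
Local Notation layer := {ffun 'I_n -> 'I_n}.
Local Notation tspp := {ffun 'I_m * 'I_m -> 'I_m.+1}.
Implicit Types (T : tspp) (g : layer).

Definition chain_fun g (c : seq layer) (k i : nat) : nat := lv (nth [ffun=> ord0] (g :: c) k) i.

Lemma lv0 i : lv ([ffun=> ord0] : layer) i = 0%N.
Proof. by rewrite /lv; case: insubP => // k _ _; rewrite ffunE. Qed.

(** Parts of layer k are at most m - k, so layer m vanishes and continuing the tuple by zero layers
    respects the interlacing conditions. *)
Lemma chain_triangle g (c : m.-tuple layer) :
  strict g -> path (@below n n) g c -> triangle m (chain_fun g c).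
Proof.
move=> sg gc.
have step k i : (k < m)%N -> if (0 < chain_fun g c k i)%N
    then (chain_fun g c k i.+1 <= chain_fun g c k.+1 i < chain_fun g c k i)%N
    else chain_fun g c k.+1 i == 0%N.
  by move=> km; have /(pathP [ffun=> ord0])/(_ k) := gc; rewrite size_tuple => /(_ km) /belowP /(_ i).
have bound k i : (k <= m)%N -> (chain_fun g c k i <= m - k)%N.
  elim: k => [_|k IHk km]; first by have := lv_lt g i; rewrite /chain_fun /=; lia.
  by have := IHk (ltnW km); move: (step k i km); case: ifP; lia.
split=> [i|k i]; first by split; [have := bound 0%N i; lia | exact: (strictP _ sg)].
case: (ltnP k m) => [/step //|mk].
have z k' i' : (m <= k')%N -> chain_fun g c k' i' = 0%N.
  rewrite leq_eqVlt => /predU1P[<-|mk']; first by have := bound m i' (leqnn _); lia.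
  by rewrite /chain_fun nth_default ?lv0 //= size_tuple.
by rewrite !z // leqW.
Qed.

Definition head_gap T : layer := mkl n m (gap T 0).
Definition tail_gap T : m.-tuple layer := [tuple mkl n m (gap T k.+1) | k < m].

Lemma lv_gap T k i : lv (mkl n m (gap T k)) i = gap T k i.
Proof.
apply: lv_mkl => [|ni]; first by have := tv_le T i (i + k); rewrite /gap; lia.
by rewrite /gap tv_out // (ltnW ni).
Qed.

Lemma chain_fun_gap T k i : chain_fun (head_gap T) (tail_gap T) k i = gap T k i.
Proof.
case: k => [|k]; first exact: lv_gap.
rewrite /chain_fun /=; case: (ltnP k m) => km; last first.
  rewrite nth_default ?size_tuple ?card_ord // lv0 /gap tv_out //.
  by apply/orP; right; lia.
by rewrite (nth_mktuple _ _ (Ordinal km)) lv_gap.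
Qed.

Lemma gap_chain T : is_tspp T ->
  strict (head_gap T) /\ path (@below n n) (head_gap T) (tail_gap T).
Proof.
move=> tT; have tG := gap_triangle tT; split.
  by apply/strictP => i; rewrite !lv_gap; apply: triangle_dec tG 0%N i.
apply/(pathP [ffun=> ord0]) => k; rewrite size_tuple => km; apply/belowP => i.
have := tG.2 k i; rewrite -!chain_fun_gap.
by rewrite /chain_fun.
Qed.

Lemma sum_tspp (V : nmodType) (F : layer -> m.-tuple layer -> V) :
  \sum_(T : tspp | is_tspp T) F (head_gap T) (tail_gap T) =
  \sum_(g | strict g) \sum_(c : m.-tuple layer | path (@below n n) g c) F g c.
Proof.
rewrite [RHS]pair_big_dep /=.
rewrite (reindex_onto (fun T => (head_gap T, tail_gap T))
   (fun p => of_triangle m (chain_fun p.1 p.2))) /=; last first.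
  move=> [g c] /= /andP[sg gc]; have tG := chain_triangle sg gc; congr pair.
    by apply: lv_inj => i; rewrite lv_gap gap_of_triangle.
  apply: eq_from_tnth => k; rewrite tnth_mktuple; apply: lv_inj => i.
  by rewrite lv_gap gap_of_triangle // /chain_fun /= -tnth_nth.
apply: eq_bigl => T; apply/idP/andP => [tT|[/andP[sg gc] /eqP <-]].
  have [-> ->] := gap_chain tT; split=> //; apply/eqP.
  exact: of_triangle_gap tT (chain_fun_gap T).
by apply: of_triangle_tspp; exact: (@chain_triangle _ (tail_gap T) sg gc).
Qed.

(** * Frobenius notation of pi(T) read off the chain *)

Lemma nth_conj_part la j : nth 0%N (conj_part la) j = count (fun x => j < x)%N la.
Proof.
rewrite /conj_part; case: (ltnP j (maxpart la)) => jm; first by rewrite nth_mkseq.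
rewrite nth_default ?size_mkseq //; apply/esym/eqP; rewrite -leqn0 leqNgt -has_count.
apply/hasPn => x xla; rewrite -leqNgt; apply: leq_trans jm.
exact: (@leq_bigmax_seq _ la xpredT id).
Qed.

Lemma durfeeE la l : (forall i, (i < nth 0%N la i)%N = (i < l)%N) -> durfee la = l.
Proof.
move=> laP; apply/eqP; rewrite eqn_leq; apply/andP; split.
  by apply/bigmax_leqP => i; rewrite laP.
case: l laP => // l laP; have ll : (l < nth 0%N la l)%N by rewrite laP.
have ls : (l < size la)%N by rewrite ltnNge; apply: contraTN ll => h; rewrite nth_default.
exact: (@leq_bigmax_cond _ _ (fun i : 'I_(size la) => i.+1) (Ordinal ls)).
Qed.

Section Data.
Variable T : tspp.
Hypothesis tT : is_tspp T.
Let sg : strict (head_gap T) := (gap_chain tT).1.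

Lemma tspp_diagE : tspp_diag T = conj_part (mkseq (fun i => tv T i i) m).
Proof.
rewrite /tspp_diag; congr conj_part; apply: (@eq_from_nth _ 0%N).
  by rewrite size_mkseq size_map size_enum_ord.
move=> i; rewrite size_map size_enum_ord => im.
rewrite nth_mkseq // (nth_map (Ordinal im)) ?size_enum_ord //.
rewrite -tv_ord nth_enum_ord //.
Qed.

Let dcount i : (i < m)%N -> (i < count (fun j => i < tv T j j)%N (iota 0 m))%N = (i < tv T i i)%N.
Proof.
by move=> im; rewrite count_downset // => j h; apply: leq_trans h _; apply: tv_dec.
Qed.

Lemma nth_tspp_diag i :
  nth 0%N (tspp_diag T) i = count (fun j => i < tv T j j)%N (iota 0 m).
Proof. by rewrite tspp_diagE nth_conj_part count_map. Qed.

Lemma durfee_tspp_diag : durfee (tspp_diag T) = size (parts (head_gap T)).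
Proof.
apply: durfeeE => i; rewrite -lv_pos // lv_gap /gap addn0 subn_gt0 nth_tspp_diag.
case: (ltnP i m) => im; first exact: dcount.
rewrite tv_out ?im // ltn0 ltnNge (leq_trans _ im) //.
by rewrite -[X in (_ <= X)%N](size_iota 0 m) count_size.
Qed.

(** The conjugate of diag(T) has the T(i, i) as its parts, so with 0-indexed i its leg is T(i, i) -
    i - 1. The shift by one in pi gives T(i, i) - i, the gap on the main diagonal. *)
Lemma pi_legsE : pi_legs T = parts (head_gap T).
Proof.
rewrite /pi_legs /frob_legs durfee_tspp_diag; apply: (@eq_from_nth _ 0%N).
  by rewrite size_map size_mkseq.
move=> i; rewrite size_map size_mkseq => il.
rewrite (nth_map 0%N) ?size_mkseq // nth_mkseq // nth_parts // lv_gap /gap addn0.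
have : (0 < lv (head_gap T) i)%N by rewrite lv_pos.
rewrite lv_gap /gap addn0 subn_gt0 => iT.
suff -> : nth 0%N (conj_part (tspp_diag T)) i = tv T i i by lia.
have im : (i < m)%N := leq_trans iT (tv_le T i i).
rewrite nth_conj_part tspp_diagE /conj_part count_map; set d := mkseq _ m.
apply: count_ltn => [|j _].
  have -> : tv T i i = nth 0%N d i by rewrite nth_mkseq.
  by apply: (@leq_bigmax_seq _ d xpredT id) => //; apply: mem_nth; rewrite size_mkseq.
rewrite /= count_map count_downset // => k h; apply: leq_trans h _; exact: tv_dec.
Qed.

(** The arm is the number of j > i with T(j, j) > i, since every j <= i is counted and then removed
    by the subtraction of i + 1. By symmetry T(j, j) > i means T(i, j) > j, that is, part i of layer
    j - i is positive. *)
Lemma pi_armsE : pi_arms T = arms (head_gap T) (tail_gap T).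
Proof.
rewrite /pi_arms /frob_arms durfee_tspp_diag; apply: (@eq_from_nth _ 0%N).
  by rewrite !size_mkseq.
move=> i; rewrite size_mkseq => il; rewrite nth_mkseq // nth_tspp_diag /arms [in RHS]nth_mkseq //.
have : (0 < lv (head_gap T) i)%N by rewrite lv_pos.
rewrite lv_gap /gap addn0 subn_gt0 => iT.
have im : (i < m)%N := leq_trans iT (tv_le T i i).
pose d := (m - i.+1)%N; have mE : m = (i.+1 + d)%N by rewrite /d; lia.
have -> : height (tail_gap T) i = count (fun k => i + k.+1 < tv T i (i + k.+1))%N (iota 0 m).
  rewrite /height count_map -val_enum_ord count_map; apply: eq_count => k /=.
  by rewrite lv_gap /gap subn_gt0.
have cubeC j : (i < tv T j j)%N = (j < tv T i j)%N.
  have /tsppP[H12 H23] := tT.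
  by rewrite -/(cube T j j i) H23 H12.
rewrite [in LHS](congr1 (iota 0) mE) iotaD count_cat add0n.
rewrite (@eq_in_count _ _ predT (iota 0 i.+1)); last first.
  move=> j; rewrite mem_iota add0n ltnS => /andP[_ ji].
  by apply: leq_trans iT _; apply: tv_dec.
rewrite count_predT size_iota addKn.
rewrite [in RHS](congr1 (iota 0) mE) addnC iotaD count_cat add0n -[i.+1 in LHS]addn0 iotaDl count_map.
rewrite (@eq_in_count _ _ pred0 (iota d i.+1)) ?count_pred0 ?addn0; last first.
  move=> k; rewrite mem_iota => /andP[dk _] /=; rewrite tv_out //.
  by apply/orP; right; rewrite /d in dk; lia.
by apply: eq_count => k /=; rewrite cubeC addnS -addSn.
Qed.
End Data.
End ChainsOfTSPP.

(** * Assembly of the identity *)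

Lemma summand_factor (R : comNzRingType) (u v w x y : R) :
  v + w * x + u * x * y = v - x * - (w + u * y).
Proof. by ring. Qed.

(** The sign is that of reversing the rows: row r of [homM] has degree n - 1 - r in [hom2], whereas
    hook rows are indexed by increasing degree. *)
Lemma asym_An_summand (R : idomainType) (u v : R) (n : nat) : v != 0 ->
  (-1) ^+ perm (@rev_ord_inj n) * asym (An_summand u v (n:=n)) =
  \det (\matrix_(c < n, j < n)
    hookrow u%:MP v%:MP (1 - u%:MP - v%:MP) n ('X_j : {mpoly R[n]}) c).
Proof.
move=> v0; pose w : {mpoly R[n]} := 1 - u%:MP - v%:MP.
pose A (j : 'I_n) : {mpoly R[n]} := v%:MP.
pose X (j : 'I_n) : {mpoly R[n]} := 'X_j.
pose b (j : 'I_n) : {mpoly R[n]} := - (w + u%:MP * 'X_j).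
have nz j : A j - X j * b j != 0.
  (* With all variables set to 0, the factor [A j - X j * b j] takes the value v. *)
  apply: contraNneq v0 => /(congr1 (meval (fun=> 0))).
  rewrite /A /X /b !(mevalB, mevalD, mevalM, mevalN, mevalXU, mevalC, meval0, mul0r, subr0).
  by move=> ->.
have -> : asym (An_summand u v (n:=n)) = \det (homM A X b).
  rewrite -(asym_det nz).
  apply: eq_bigr => s _.
  congr (_ * (_ * _)).
  apply: eq_bigr => i _; apply: eq_bigr => j _.
  by rewrite /A /X /b /w !mpolyCB mpolyC1 summand_factor.
rewrite -det_rev det_hookrow; congr (\det _); apply/matrixP => i j; rewrite !mxE /=.
have li := ltn_ord i; rewrite /X /A /b.
congr (_ ^+ _ * hom2 _ _ _); lia.
Qed.

Lemma det_vdm (R : comNzRingType) n :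
  \det (\matrix_(i < n, j < n) ('X_j : {mpoly R[n]}) ^+ i) = vdm R n.
Proof.
have := det_Vandermonde (\row_j ('X_j : {mpoly R[n]})); rewrite /vdm.
under [X in _ = X]eq_bigr => i _ do under eq_bigr => j _ do rewrite !mxE.
by move=> <-; congr (\det _); apply/matrixP => i j; rewrite !mxE.
Qed.

Lemma omegaC (R : comNzRingType) (u v : R) k n a c :
  omega (u%:MP : {mpoly R[k]}) v%:MP n a c = (omega u v n a c)%:MP.
Proof. by rewrite /omega -mpolyC1 -!rmorphB -!rmorphXn -!rmorphM. Qed.

Theorem asym_tspp (R : idomainType) (u v : R) (m : nat) : v != 0 ->
  asym (An_summand u v (n:=m.+1)) =
  vdm R m.+1 *
  \sum_(T : {ffun 'I_m * 'I_m -> 'I_m.+1} | is_tspp T)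
     (omega u v m.+1 (pi_arms T) (pi_legs T))%:MP * schur R m.+1 (pi_part T).
Proof.
move=> v0; set n := m.+1.
(* The reversal sign occurs on both sides, since the alternant of the empty partition has exponents
   n - 1 - i where [vdm] has i. *)
pose eps : {mpoly R[n]} := (-1) ^+ perm (@rev_ord_inj n).
have epsI : injective ( *%R eps) by apply: (can_inj (g := *%R eps)) => p; rewrite mulrA -expr2 sqrr_sign mul1r.
apply: epsI; rewrite asym_An_summand // det_hookrow_chains.
pose F g (c : m.-tuple {ffun 'I_n -> 'I_n}) : {mpoly R[n]} :=
  (omega u v n (arms g c) (parts g))%:MP * schur R n (part_of_frob (arms g c) (parts g)).
transitivity (eps * vdm R n * \sum_(g : {ffun 'I_n -> 'I_n} | strict g)
   \sum_(c : m.-tuple {ffun 'I_n -> 'I_n} | path (@below n n) g c) F g c).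
  rewrite mulr_sumr; apply: eq_bigr => g sg; rewrite mulr_sumr; apply: eq_bigr => c gc.
  have [srt sz _] := part_of_frobP sg gc (eq_leq (esym (size_tuple c))).
  rewrite (@schur_alternant _ _ (fun j => 'X_j)) // omegaC mulrCA; congr (_ * _).
  rewrite -det_vdm -det_rev; congr (\det _); apply/matrixP => i j; rewrite !mxE /=.
  by rewrite subSS.
rewrite -(sum_tspp F) mulrA; congr (_ * _); apply: eq_bigr => T tT.
by rewrite /F /pi_part pi_armsE // pi_legsE.
Qed.

(* A_n = ASym[...] / Vandermonde, stated as ASym[...] = Vandermonde * RHS
   in Z[u,v][x_1..x_n] (an integral domain, Vandermonde nonzero). *)
Theorem theorem1p3 (n : nat) (hn : (0 < n)%N) :
  asym (An_summand uu vv (n:=n)) =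
  vdm Zuv n *
  \sum_(T : {ffun 'I_n.-1 * 'I_n.-1 -> 'I_n.-1.+1} | is_tspp T)
     (omega uu vv n (pi_arms T) (pi_legs T))%:MP * schur Zuv n (pi_part T).
Proof.
case: n hn => // m _; apply: asym_tspp.
(* [vv] is nonzero because it evaluates to 1 when both indeterminates are set to 1. *)
apply/eqP => /(congr1 (meval (fun=> 1))).
by rewrite mevalXU meval0 => /eqP; rewrite oner_eq0.
Qed.
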